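(* Let $k$ be a positive integer, let $\alpha,\beta$ be two nonconstant inner functions, let $k\leq\dim K_\alpha$ and let $U:K_\alpha\to K_\beta$ be a bounded linear operator. Then $$S^*_\beta U=U(S^*_\alpha)^k$$ if and only if $U\in\mathcal{S}_k(\alpha,\beta)$ and $U=U_{\varphi}^{\alpha,\beta}$ for some $$\varphi\in\overline{\alpha}\,zK_{\gcd(\alpha,W^*_k\beta)}.$$
   Context: $L^2=L^2(\mathbb{T},m)$ with $m$ normalized Lebesgue measure on the unit circle $\mathbb{T}$; $H^2\subset L^2$ is the Hardy space of the unit disk and $H^\infty=H^2\cap L^\infty$. An inner function is $\alpha\in H^\infty$ with $|\alpha|=1$ a.e. on $\mathbb{T}$; $K_\alpha=H^2\ominus\alpha H^2$ (so $K_\alpha=\{0\}$ if $\alpha$ is constant), $P_\alpha$ is the orthogonal projection of $L^2$ onto $K_\alpha$, $K_\alpha^\infty=K_\alpha\cap H^\infty$ (dense in $K_\alpha$), and $S_\alpha f=P_\alpha(zf)$, $f\in K_\alpha$, is the compressed shift, with adjoint $S_\alpha^*$. $\gcd$ denotes the greatest common inner divisor. $W_k:L^2\to L^2$ is the bounded linear operator with $W_k(z^n)=z^{n/k}$ if $k\mid n$ and $W_k(z^n)=0$ otherwise ($n\in\mathbb{Z}$); its adjoint is $W_k^*g(z)=g(z^k)$, so $W_k^*\beta$ is inner. For $\varphi\in L^2$ put $U_\varphi^{\alpha,\beta}f=P_\beta W_k(\varphi f)$, $f\in K_\alpha^\infty$. $\mathcal{S}_k(\alpha,\beta)$ is the set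 of all operators $U_\varphi^{\alpha,\beta}$, $\varphi\in L^2$, that extend boundedly to $K_\alpha$ (each identified with its bounded extension $K_\alpha\to K_\beta$). *)

(* Defs.v *)
From HB Require Import structures.
From mathcomp Require Import all_boot all_order all_algebra.
From mathcomp Require Import all_classical all_reals all_analysis.
From mathcomp Require Import complex.

Set Implicit Arguments.
Unset Strict Implicit.
Unset Printing Implicit Defensive.

Import Order.TTheory GRing.Theory Num.Theory ComplexField.Normc.

Local Open Scope classical_set_scope.
Local Open Scope complex_scope.
Local Open Scope ring_scope.

(* A function on the unit circle is represented by a total function
   [R[i] -> R[i]] of which only the values on the circle matter.  The
   normalized Lebesgue measure on the circle is the image of the Lebesgue
   measure on [arc] = [0, 1[ under [circ].  Elements of L^2 are functions, not
   classes: equality of elements of L^2 is [aeq], and operators act on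
   representatives. *)

Section Circle.
Context {R : realType}.
Local Notation C := R[i].

Definition circ (t : R) : C := cos (2 * pi * t) +i* sin (2 * pi * t).

Definition arc : set R := [set` `[0, 1[].

Definition aeq (f g : C -> C) : Prop :=
  ae_eq (@lebesgue_measure R) arc (f \o circ) (g \o circ).

Definition cmeasurable (f : C -> C) : Prop :=
  measurable_fun arc (fun t : R => complex.Re (f (circ t))) /\
  measurable_fun arc (fun t : R => complex.Im (f (circ t))).

Definition cint (f : C -> C) : C :=
  (\int[@lebesgue_measure R]_(t in arc) complex.Re (f (circ t))) +i*
  (\int[@lebesgue_measure R]_(t in arc) complex.Im (f (circ t))).

Definition L2 : set (C -> C) := [set f | cmeasurable f /\
  (@lebesgue_measure R).-integrable arc
    (fun t : R => (normc (f (circ t)) ^+ 2)%:E)].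

Definition L2norm (f : C -> C) : R :=
  Num.sqrt (\int[@lebesgue_measure R]_(t in arc) normc (f (circ t)) ^+ 2).

Definition L2dot (f g : C -> C) : C := cint (fun z => f z * (g z)^*).

Definition zpow (n : int) : C -> C := fun z => z ^ n.

Definition H2 : set (C -> C) :=
  [set f | L2 f /\ forall n : int, n < 0 -> L2dot f (zpow n) = 0].

Definition Linf : set (C -> C) := [set f | cmeasurable f /\
  exists M : R, {ae @lebesgue_measure R,
    forall t, arc t -> normc (f (circ t)) <= M}].

Definition Hinf : set (C -> C) := H2 `&` Linf.

Definition is_inner (alpha : C -> C) : Prop :=
  Hinf alpha /\
  {ae @lebesgue_measure R, forall t, arc t -> normc (alpha (circ t)) = 1}.

Definition is_constant (alpha : C -> C) : Prop :=
  exists c : C, aeq alpha (fun=> c).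

Definition inner_dvd (delta alpha : C -> C) : Prop :=
  exists2 eta, is_inner eta & aeq alpha (fun z => delta z * eta z).

(* Determined up to a unimodular constant, which does not affect
   [model gamma]. *)
Definition is_inner_gcd (alpha beta gamma : C -> C) : Prop :=
  [/\ is_inner gamma, inner_dvd gamma alpha, inner_dvd gamma beta &
      forall delta, is_inner delta -> inner_dvd delta alpha ->
        inner_dvd delta beta -> inner_dvd delta gamma].

Definition model (alpha : C -> C) : set (C -> C) :=
  [set f | H2 f /\ forall h, H2 h -> L2dot f (fun z => alpha z * h z) = 0].

Definition model_inf (alpha : C -> C) : set (C -> C) := model alpha `&` Hinf.

Definition dim_ge (K : set (C -> C)) (k : nat) : Prop :=
  exists2 e : 'I_k -> C -> C, (forall i, K (e i)) &
    forall c : 'I_k -> C,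
      aeq (fun z => \sum_(i < k) c i * e i z) (fun=> 0) -> forall i, c i = 0.

Definition bounded_linear (K L : set (C -> C)) (U : (C -> C) -> (C -> C)) :
    Prop :=
  [/\ forall f, K f -> L (U f),
      forall f g, K f -> K g -> aeq f g -> aeq (U f) (U g),
      forall (c : C) f g, K f -> K g ->
        aeq (U (fun z => c * f z + g z)) (fun z => c * U f z + U g z) &
      exists M : R, forall f, K f -> L2norm (U f) <= M * L2norm f].

(* [orthproj K f] is a representative of the orthogonal projection of [f] onto
   [K]; [xget] returns the default value [0] only if no such function exists. *)
Definition orthproj (K : set (C -> C)) (f : C -> C) : C -> C :=
  xget (fun=> 0)
    [set p | K p /\ forall h, K h -> L2dot (fun z => f z - p z) h = 0].

Definition adjoint (K : set (C -> C)) (A : (C -> C) -> (C -> C)) :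
    (C -> C) -> (C -> C) :=
  fun g => xget (fun=> 0)
    [set h | K h /\ forall f, K f -> L2dot (A f) g = L2dot f h].

Definition cshift (alpha : C -> C) : (C -> C) -> (C -> C) :=
  fun f => orthproj (model alpha) (fun z => z * f z).

Definition cshift_adj (alpha : C -> C) : (C -> C) -> (C -> C) :=
  adjoint (model alpha) (cshift alpha).

(* The two clauses determine [W f] up to [aeq] for [f] in [L2], since
   trigonometric polynomials are dense. *)
Definition is_Wop (k : nat) (W : (C -> C) -> (C -> C)) : Prop :=
  bounded_linear L2 L2 W /\
  forall n : int, aeq (W (zpow n))
    (if (k%:Z %| n)%Z then zpow (n %/ k%:Z)%Z else fun=> 0).

Definition Wop (k : nat) : (C -> C) -> (C -> C) :=
  xget (idfun : (C -> C) -> (C -> C)) (is_Wop k).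

Definition Wadj (k : nat) (g : C -> C) : C -> C := fun z => g (z ^+ k).

Definition Uop (k : nat) (beta phi : C -> C) : (C -> C) -> (C -> C) :=
  fun f => orthproj (model beta) (Wop k (fun z => phi z * f z)).

(* The bounded operator [U] on [model alpha] is the extension of the operator
   with symbol [phi], which is defined on [model_inf alpha]. *)
Definition has_symbol (k : nat) (alpha beta phi : C -> C)
    (U : (C -> C) -> (C -> C)) : Prop :=
  forall f, model_inf alpha f -> aeq (U f) (Uop k beta phi f).

Definition Sclass (k : nat) (alpha beta : C -> C) :
    set ((C -> C) -> (C -> C)) :=
  [set U | bounded_linear (model alpha) (model beta) U /\
    exists2 phi, L2 phi & has_symbol k alpha beta phi U].

(* The space \overline{alpha} z K_gamma. *)
Definition conj_z_model (alpha gamma : C -> C) : set (C -> C) :=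
  [set phi | L2 phi /\
    exists2 h, model gamma h & aeq phi (fun z => (alpha z)^* * z * h z)].

End Circle.

(* Main.v *)
Require Import Defs.
From mathcomp Require Import all_boot all_order all_algebra.
From mathcomp Require Import all_classical all_reals all_analysis.
From mathcomp Require Import measurable_realfun.
From mathcomp Require Import complex ring lra zify.

(* Write S and T for the adjoints of the compressed shifts of alpha and beta.  If
   T U = U S^k, then U is determined by the functional f |-> (U f)(0) = <f, g>,
   with g in K_alpha: the n-th Fourier coefficient of U f is
   (U S^(kn) f)(0) = <f, z^(kn) g>, that is, U f = P_+ W_k (conj g f) for bounded f.
   Testing that U f lies in K_beta on f = P_+ (zbar^m alpha), m > 0, gives
   g beta(z^k) in alpha H^2.  Writing alpha = gamma a1 and beta(z^k) = gamma b1 with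
   a1 and b1 coprime, Beurling's theorem shows that a1 H^2 + b1 H^2 is dense in H^2,
   whence g is in a1 K_gamma, which is the condition on phi = conj g.  The converse
   is the same computation read backwards, for bounded f and then by density. *)

Set Implicit Arguments.
Unset Strict Implicit.
Unset Printing Implicit Defensive.

Import Order.TTheory GRing.Theory Num.Theory ComplexField.Normc.
Import numFieldNormedType.Exports.

Local Open Scope classical_set_scope.
Local Open Scope complex_scope.
Local Open Scope ring_scope.

(** * Complex numbers and the circle *)

(** Equality in L^2 is [aeq], and [orthproj], [adjoint] and [Wop] are picked by [xget]: each must be
    shown to exist and is then known only through its inner products. Existence always comes from
    one Riesz theorem for the subspaces [orthc S], for which completeness of L^2 is proved here, and
    density arguments become comparisons of Riesz representatives, settled by uniqueness of Fourier
    coefficients. The obstacle is that [phi] is only square integrable, so [phi f] need not be in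
    L^2 when [f] is unbounded. What links the two directions is therefore the identity
    [<U f, z^n> = <f, z^(kn) conj phi>] for [n >= 0], whose right side makes sense on all of K_alpha
    and is continuous in [f]. The factor [zbar] hidden in the condition on [phi] comes from the
    conjugation [h -> gamma conj(z h)] of K_gamma, which turns that condition into [conj phi] in
    [a1 K_gamma]. *)

Section ComplexNumbers.
Context {R : realType}.
Local Notation C := R[i].
Implicit Types x y : C.

Lemma RecM x y : complex.Re (x * y) =
  complex.Re x * complex.Re y - complex.Im x * complex.Im y.
Proof. by case: x y => [a b] [c d]. Qed.

Lemma ImcM x y : complex.Im (x * y) =
  complex.Re x * complex.Im y + complex.Im x * complex.Re y.
Proof. by case: x y => [a b] [c d]. Qed.

Lemma RecD x y : complex.Re (x + y) = complex.Re x + complex.Re y.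
Proof. by case: x y => [a b] [c d]. Qed.

Lemma ImcD x y : complex.Im (x + y) = complex.Im x + complex.Im y.
Proof. by case: x y => [a b] [c d]. Qed.

Lemma RecJ x : complex.Re x^* = complex.Re x.
Proof. by case: x. Qed.

Lemma ImcJ x : complex.Im x^* = - complex.Im x.
Proof. by case: x. Qed.

Lemma normcJE x : normc x^* = normc x.
Proof. by case: x => a b /=; rewrite sqrrN. Qed.

Lemma normc2E x : normc x ^+ 2 = complex.Re x ^+ 2 + complex.Im x ^+ 2.
Proof. by case: x => a b /=; rewrite sqr_sqrtr// addr_ge0// sqr_ge0. Qed.

Lemma normc_ge0 x : 0 <= normc x.
Proof. by case: x => a b; exact: sqrtr_ge0. Qed.

Lemma normRe x : `|complex.Re x| <= normc x.
Proof.
rewrite -(@ler_pXn2r _ 2)// ?nnegrE ?normc_ge0//.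
by rewrite normc2E real_normK ?num_real// lerDl sqr_ge0.
Qed.

Lemma normIm x : `|complex.Im x| <= normc x.
Proof.
rewrite -(@ler_pXn2r _ 2)// ?nnegrE ?normc_ge0//.
by rewrite normc2E real_normK ?num_real// lerDr sqr_ge0.
Qed.

Lemma mulcJ x : x * x^* = (normc x ^+ 2)%:C.
Proof.
by rewrite normc2E; case: x => a b; congr Complex => /=; ring.
Qed.

Lemma complex_eqP x y : complex.Re x = complex.Re y ->
  complex.Im x = complex.Im y -> x = y.
Proof. by case: x y => [a b] [c d] /= -> ->. Qed.

Lemma mulcJ1 x : normc x = 1 -> x * x^* = 1.
Proof. by move=> x1; rewrite mulcJ x1 expr1n. Qed.

Lemma normc_conj_eq1 x : x * x^* = 1 -> normc x = 1.
Proof.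
rewrite mulcJ => -[] x1; apply/eqP.
by rewrite -(@eqrXn2 _ 2)// ?normc_ge0// expr1n x1.
Qed.

Lemma cJK x : x^*^* = x.
Proof. by apply: complex_eqP; rewrite ?RecJ ?ImcJ ?opprK. Qed.

Lemma cJM x y : (x * y)^* = x^* * y^*.
Proof. by apply: complex_eqP; rewrite !(RecJ, ImcJ, RecM, ImcM); ring. Qed.

Lemma cJD x y : (x + y)^* = x^* + y^*.
Proof. by apply: complex_eqP; rewrite !(RecJ, ImcJ, RecD, ImcD); ring. Qed.

Lemma cJB x y : (x - y)^* = x^* - y^*.
Proof. by case: x y => [a b] [c d]; apply: complex_eqP => //=; ring. Qed.

Lemma cJr (a : R) : (a%:C)^* = a%:C.
Proof. by apply: complex_eqP; rewrite /= ?oppr0. Qed.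

Lemma cJ1 : 1^* = 1 :> C.
Proof. by apply: complex_eqP; rewrite /= ?oppr0. Qed.

Lemma cJ0 : 0^* = 0 :> C.
Proof. by apply: complex_eqP; rewrite /= ?oppr0. Qed.

Lemma real_complexM (a b : R) : (a * b)%:C = a%:C * b%:C.
Proof. by rewrite rmorphM. Qed.

End ComplexNumbers.

Section Circle.
Context {R : realType}.
Local Notation C := R[i].

Lemma circD (s t : R) : circ (s + t) = circ s * circ t.
Proof.
rewrite /circ mulrDr cosD sinD; congr Complex => //.
by rewrite addrC [X in X + _]mulrC [X in _ + X]mulrC addrC [X in X + _]mulrC.
Qed.

Lemma circ0 : circ (0 : R) = 1.
Proof. by rewrite /circ mulr0 cos0 sin0. Qed.

Lemma normc_circ (t : R) : normc (circ t) = 1.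
Proof. by rewrite /= cos2Dsin2 sqrtr1. Qed.

Lemma circJ (t : R) : circ t * (circ t)^* = 1.
Proof. by rewrite mulcJ1// normc_circ. Qed.

Lemma circ_neq0 (t : R) : circ t != 0.
Proof.
apply/eqP => c0; have := circJ t; rewrite c0 mul0r => /eqP.
by rewrite eq_sym oner_eq0.
Qed.

Lemma circN (t : R) : circ (- t) = (circ t)^-1.
Proof.
apply: (mulfI (circ_neq0 t)); rewrite divff ?circ_neq0//.
by rewrite -circD subrr circ0.
Qed.

Lemma circVJ (t : R) : (circ t)^-1 = (circ t)^*.
Proof. by apply: (mulfI (circ_neq0 t)); rewrite divff ?circ_neq0// circJ. Qed.

Lemma circX (t : R) (n : nat) : circ t ^+ n = circ (n%:R * t).
Proof.
elim: n => [|n IH]; first by rewrite mul0r circ0 expr0.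
by rewrite exprS IH -circD -natr1 mulrDl mul1r addrC.
Qed.

Lemma circXz (t : R) (n : int) : circ t ^ n = circ (n%:~R * t).
Proof.
case: n => n; first by rewrite -exprnP circX.
by rewrite NegzE -exprnN circX mulNr circN.
Qed.

Lemma circ_int (n : int) : circ (n%:~R : R) = 1.
Proof.
have -> : n%:~R = n%:~R * 1 :> R by rewrite mulr1.
rewrite -circXz.
suff -> : circ (1 : R) = 1 by rewrite exp1rz.
by rewrite /circ mulr1 mulr_natl cos2pi sin2pi.
Qed.

(** Multiplicativity of [zpow] fails at 0 and its conjugation rule fails off the circle, so
    pointwise rewriting is relativised to these points. *)
Definition on_circle (z : C) := exists t, z = circ t.

Lemma onc_circ (t : R) : on_circle (circ t).
Proof. by exists t. Qed.

Lemma onc_neq0 z : on_circle z -> z != 0.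
Proof. by move=> [t ->]; exact: circ_neq0. Qed.

Lemma zpowD (m n : int) z : on_circle z -> zpow (m + n) z = zpow m z * zpow n z.
Proof. by move=> /onc_neq0 z0; rewrite /zpow expfzDr. Qed.

Lemma zpowJ (n : int) z : on_circle z -> (zpow n z)^* = zpow (- n) z.
Proof.
move=> [t ->]; rewrite /zpow circXz -circVJ -circN circXz.
by rewrite rmorphN mulNr.
Qed.

Lemma zpow_circ (n : int) (t : R) : zpow n (circ t) = circ (n%:~R * t).
Proof. by rewrite /zpow circXz. Qed.

Lemma zpow0 z : zpow 0 z = 1 :> C.
Proof. by []. Qed.

Lemma zpow1 z : zpow 1 z = z :> C.
Proof. by []. Qed.

End Circle.

(** * Integration on the circle *)

Section Integration.
Context {R : realType}.
Local Notation C := R[i].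
Local Notation mu := (@lebesgue_measure R).
Local Notation arc := (@Defs.arc R).
Implicit Types (f g h : C -> C) (u v : R -> R).

Lemma measurable_arc : measurable (arc : set (measurableTypeR R)).
Proof. exact: measurable_itv. Qed.

(* The same fact for the other measurable structure inferred on [R]. *)
Lemma measurable_arcR : measurable arc.
Proof. exact: measurable_itv. Qed.
Hint Resolve measurable_arc measurable_arcR : core.

Lemma mu_arc : mu arc = 1%E.
Proof.
by rewrite /Defs.arc lebesgue_measure_itv/= lte_fin ltr01 -EFinB subr0.
Qed.

Definition rintegrable (u : R -> R) := mu.-integrable arc (EFin \o u).

Lemma rI_meas u : rintegrable u -> measurable_fun arc u.
Proof. by move=> /measurable_int /measurable_EFinP. Qed.

Lemma rI_dom u v : measurable_fun arc u -> rintegrable v ->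
  (forall t, arc t -> `|u t| <= v t) -> rintegrable u.
Proof.
move=> mu_ iv uv; apply: (le_integrable measurable_arc _ _ iv).
  exact/measurable_EFinP.
by move=> t /uv h /=; rewrite lee_fin (le_trans h)// ler_norm.
Qed.

Lemma rI_cst (c : R) : rintegrable (cst c).
Proof.
apply: measurable_bounded_integrable => //.
- have h : (mu arc < +oo)%E by rewrite mu_arc ltry.
  exact: h.
- by exists `|c|; split; [exact: num_real|move=> x /ltW h y _ /=].
Qed.

Lemma rID u v : rintegrable u -> rintegrable v -> rintegrable (fun t => u t + v t).
Proof. by move=> iu iv; have := integrableD measurable_arc iu iv. Qed.

Lemma rIZ (k : R) u : rintegrable u -> rintegrable (fun t => k * u t).
Proof. by move=> iu; have := integrableZl measurable_arc k iu. Qed.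

Lemma rIB u v : rintegrable u -> rintegrable v -> rintegrable (fun t => u t - v t).
Proof. by move=> iu iv; have := integrableB measurable_arc iu iv. Qed.

Lemma rI_ext u v : (forall t, arc t -> u t = v t) -> rintegrable u -> rintegrable v.
Proof.
move=> uv; apply: eq_integrable => // t; rewrite inE => /uv h.
by rewrite /= h.
Qed.

Lemma rI_aeq u v : measurable_fun arc v ->
  ae_eq mu arc u v -> rintegrable u -> rintegrable v /\
  (\int[mu]_(t in arc) u t = \int[mu]_(t in arc) v t).
Proof.
move=> mv uv iu.
have muv : ae_eq mu arc (EFin \o u) (EFin \o v).
  by apply: filterS uv => t h /h /= ->.
have mv' : measurable_fun arc (EFin \o v) by exact/measurable_EFinP.
have mu' : measurable_fun arc (EFin \o u) by exact: measurable_int iu.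
split; last first.
  by rewrite /Rintegral; congr fine; apply: ae_eq_integral.
apply/integrableP; split => //.
move/integrableP : iu => [_].
congr (_ < _)%E; apply: ae_eq_integral => //; do ?exact: measurableT_comp.
by apply: filterS muv => t h /h ->.
Qed.

Lemma rint_ext u v : (forall t, arc t -> u t = v t) ->
  \int[mu]_(t in arc) u t = \int[mu]_(t in arc) v t.
Proof. by move=> uv; apply: eq_Rintegral => t; rewrite inE => /uv. Qed.

Lemma cmeas_ext f g : (forall z, on_circle z -> f z = g z) ->
  cmeasurable f -> cmeasurable g.
Proof.
move=> fg [mr mi]; split.
  by apply: eq_measurable_fun mr => t _ /=; rewrite fg//; exists t.
by apply: eq_measurable_fun mi => t _ /=; rewrite fg//; exists t.
Qed.

Lemma cmeas_cst (c : C) : cmeasurable (fun=> c).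
Proof. by split; exact: measurable_cst. Qed.

Lemma cmeasD f g : cmeasurable f -> cmeasurable g ->
  cmeasurable (fun z => f z + g z).
Proof.
move=> [a b] [c d]; split.
  under eq_fun do rewrite RecD; exact: measurable_funD.
under eq_fun do rewrite ImcD; exact: measurable_funD.
Qed.

Lemma cmeasM f g : cmeasurable f -> cmeasurable g ->
  cmeasurable (fun z => f z * g z).
Proof.
move=> [a b] [c d]; split.
  under eq_fun do rewrite RecM.
  by apply: measurable_funB; exact: measurable_funM.
under eq_fun do rewrite ImcM.
by apply: measurable_funD; exact: measurable_funM.
Qed.

Lemma cmeasJ f : cmeasurable f -> cmeasurable (fun z => (f z)^*).
Proof.
move=> [a b]; split.
  by under eq_fun do rewrite RecJ.
by under eq_fun do rewrite ImcJ; exact: measurableT_comp.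
Qed.

Lemma continuous_lin_comp (a : R) (F : R -> R) :
  continuous F -> continuous (fun t => F (a * t)).
Proof.
move=> cF t; apply: (@continuous_comp _ _ _ (fun t => a * t) F); last exact: cF.
exact: mulrl_continuous.
Qed.

Lemma cmeas_zpow (n : int) : cmeasurable (zpow n : C -> C).
Proof.
split; under eq_fun do rewrite zpow_circ /circ /=;
  apply: measurable_funTS; apply: continuous_measurable_fun;
  apply: (@continuous_lin_comp n%:~R (fun t => _ (2 * pi * t)));
  apply: continuous_lin_comp => x; [exact: continuous_cos|exact: continuous_sin].
Qed.

Lemma cmeas_norm2 f : cmeasurable f ->
  measurable_fun arc (fun t => normc (f (circ t)) ^+ 2).
Proof.
move=> [a b]; under eq_fun do rewrite normc2E.
by apply: measurable_funD; exact: measurable_funX.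
Qed.

Lemma cmeas_norm f : cmeasurable f ->
  measurable_fun arc (fun t => normc (f (circ t))).
Proof.
move=> mf.
have -> : (fun t => normc (f (circ t))) =
    (fun t => Num.sqrt (normc (f (circ t)) ^+ 2)).
  by apply/funext => t; rewrite sqrtr_sqr ger0_norm// normc_ge0.
apply: measurableT_comp; last exact: cmeas_norm2.
apply: continuous_measurable_fun; exact: sqrt_continuous.
Qed.

Definition cintegrable f := rintegrable (fun t => complex.Re (f (circ t))) /\
  rintegrable (fun t => complex.Im (f (circ t))).

Lemma CI_cmeas f : cintegrable f -> cmeasurable f.
Proof. by move=> [/rI_meas a /rI_meas b]. Qed.

Lemma CI_dom f (v : R -> R) : cmeasurable f -> rintegrable v ->
  (forall t, arc t -> normc (f (circ t)) <= v t) -> cintegrable f.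
Proof.
move=> [a b] iv fv; split.
  by apply: (rI_dom a iv) => t /fv /(le_trans (normRe _)).
by apply: (rI_dom b iv) => t /fv /(le_trans (normIm _)).
Qed.

Lemma CI_ext f g : (forall z, on_circle z -> f z = g z) -> cintegrable f -> cintegrable g.
Proof.
by move=> fg [a b]; split; [apply: rI_ext a|apply: rI_ext b] => t _ /=;
  rewrite fg//; exists t.
Qed.

Lemma CI_norm f : cintegrable f -> rintegrable (fun t => normc (f (circ t))).
Proof.
move=> If; have [a b] := If.
apply: (@rI_dom _ (fun t => `|complex.Re (f (circ t))| + `|complex.Im (f (circ t))|)).
- by apply: cmeas_norm; exact: CI_cmeas.
- by apply: rID; exact: integrable_norm.
- move=> t _; rewrite ger0_norm ?normc_ge0//.
  rewrite -(@ler_pXn2r _ 2)// ?nnegrE ?normc_ge0 ?addr_ge0//.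
  rewrite normc2E sqrrD !real_normK ?num_real// lerD2r lerDl.
  by rewrite mulrn_wge0// mulr_ge0.
Qed.

Lemma CI_norml f : cmeasurable f -> rintegrable (fun t => normc (f (circ t))) -> cintegrable f.
Proof. by move=> mf If; apply: (CI_dom mf If). Qed.

Lemma CID f g : cintegrable f -> cintegrable g -> cintegrable (fun z => f z + g z).
Proof.
move=> [a b] [c d]; split; rewrite /comp/=.
  by under eq_fun do rewrite RecD; exact: rID.
by under eq_fun do rewrite ImcD; exact: rID.
Qed.

Lemma CIZ (k : C) f : cintegrable f -> cintegrable (fun z => k * f z).
Proof.
move=> [a b]; split; rewrite /comp/=.
  by under eq_fun do rewrite RecM; apply: rIB; exact: rIZ.
by under eq_fun do rewrite ImcM; apply: rID; exact: rIZ.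
Qed.

Lemma CI_cst (c : C) : cintegrable (fun=> c).
Proof. by split; exact: rI_cst. Qed.

Lemma cint_ext f g : (forall z, on_circle z -> f z = g z) -> cint f = cint g.
Proof.
by move=> fg; rewrite /cint; congr Complex; apply: rint_ext => t _;
  rewrite fg//; exists t.
Qed.

Lemma cint_aeq f g : cintegrable f -> cmeasurable g -> aeq f g ->
  cintegrable g /\ cint f = cint g.
Proof.
move=> [a b] [c d] fg.
have [|ir er] := rI_aeq c _ a.
  by apply: filterS fg => t h /h /= ->.
have [|ii ei] := rI_aeq d _ b.
  by apply: filterS fg => t h /h /= ->.
by split => //; rewrite /cint; congr Complex.
Qed.

Lemma cintD f g : cintegrable f -> cintegrable g ->
  cint (fun z => f z + g z) = cint f + cint g.
Proof.
move=> [a b] [c d]; apply: complex_eqP => /=.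
  by under eq_Rintegral do rewrite RecD; rewrite RintegralD.
by under eq_Rintegral do rewrite ImcD; rewrite RintegralD.
Qed.

Lemma cintZ (k : C) f : cintegrable f -> cint (fun z => k * f z) = k * cint f.
Proof.
move=> [a b]; apply: complex_eqP => /=.
  rewrite RecM; under eq_Rintegral do rewrite RecM.
  rewrite RintegralB//; [|exact: rIZ|exact: rIZ].
  by rewrite !RintegralZl.
rewrite ImcM; under eq_Rintegral do rewrite ImcM.
rewrite RintegralD//; [|exact: rIZ|exact: rIZ].
by rewrite !RintegralZl.
Qed.

Lemma cintJ f : cintegrable f -> cint (fun z => (f z)^*) = (cint f)^*.
Proof.
move=> [a b]; apply: complex_eqP; rewrite ?RecJ ?ImcJ /=.
  by under eq_Rintegral do rewrite RecJ.
under eq_Rintegral do rewrite ImcJ -mulN1r.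
by rewrite RintegralZl// mulN1r.
Qed.

Lemma lebesgue_ae_filter : Filter (almost_everywhere mu).
Proof. exact: (@ae_filter_ringOfSetsType _ (measurableTypeR R) _ mu). Qed.

Lemma aeS (P Q : R -> Prop) :
  {ae mu, forall t, P t} -> (forall t, P t -> Q t) -> {ae mu, forall t, Q t}.
Proof. by move=> p pq; apply: (@filterS _ _ lebesgue_ae_filter) p. Qed.

Lemma aeS2 (P Q S : R -> Prop) : {ae mu, forall t, P t} ->
  {ae mu, forall t, Q t} -> (forall t, P t -> Q t -> S t) ->
  {ae mu, forall t, S t}.
Proof. by move=> p q pq; apply: (@filterS2 _ _ lebesgue_ae_filter) p q. Qed.

Lemma aeq_refl f : aeq f f.
Proof. exact: aeW. Qed.

Lemma aeq_sym f g : aeq f g -> aeq g f.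
Proof. by move=> h; apply: filterS h => t h /h. Qed.

Lemma aeq_trans f g h : aeq f g -> aeq g h -> aeq f h.
Proof. by move=> a b; apply: filterS2 a b => t x y at_; rewrite x ?y. Qed.

(** With [aeq_mono2] and [aeq_mono3], this reduces an a.e. identity to algebra at a single point of
    the circle, where the given identities hold exactly. *)
Lemma aeq_mono f g f' g' : aeq f g ->
  (forall z, on_circle z -> f z = g z -> f' z = g' z) -> aeq f' g'.
Proof.
by move=> a h; apply: filterS a => t x /x /= e; apply: h => //; exists t.
Qed.

Lemma aeq_mono2 f1 g1 f2 g2 f g : aeq f1 g1 -> aeq f2 g2 ->
  (forall z, on_circle z -> f1 z = g1 z -> f2 z = g2 z -> f z = g z) -> aeq f g.
Proof.
move=> a b h; apply: filterS2 a b => t x y at_ /=.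
by apply: h; [exists t|exact: x|exact: y].
Qed.

Lemma aeq_mono3 f1 g1 f2 g2 f3 g3 f g : aeq f1 g1 -> aeq f2 g2 -> aeq f3 g3 ->
  (forall z, on_circle z -> f1 z = g1 z -> f2 z = g2 z -> f3 z = g3 z ->
    f z = g z) -> aeq f g.
Proof.
move=> a b c h; apply: filterS3 a b c => t x y w at_ /=.
by apply: h; [exists t|exact: x|exact: y|exact: w].
Qed.

End Integration.
#[global] Hint Resolve measurable_arc measurable_arcR : core.

(** * The space L^2 *)

Section L2space.
Context {R : realType}.
Local Notation C := R[i].
Local Notation mu := (@lebesgue_measure R).
Local Notation arc := (@Defs.arc R).
Implicit Types (f g h : C -> C) (b : C -> C).

Definition nrm2 f : R := \int[mu]_(t in arc) normc (f (circ t)) ^+ 2.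

Lemma normc2_ge0 (x : C) : 0 <= normc x ^+ 2.
Proof. exact: sqr_ge0. Qed.

Lemma L2_cmeas f : L2 f -> cmeasurable f.
Proof. by case. Qed.

Lemma L2_rI f : L2 f -> rintegrable (fun t => normc (f (circ t)) ^+ 2).
Proof. by case. Qed.

Lemma L2_dom f (v : R -> R) : cmeasurable f -> rintegrable v ->
  (forall t, arc t -> normc (f (circ t)) ^+ 2 <= v t) -> L2 f.
Proof.
move=> mf iv fv; split => //; apply: (rI_dom _ iv); first exact: cmeas_norm2.
by move=> t /fv; rewrite ger0_norm// normc2_ge0.
Qed.

Lemma L2_ext f g : (forall z, on_circle z -> f z = g z) -> L2 f -> L2 g.
Proof.
move=> fg [mf If]; split; first exact: cmeas_ext mf.
by apply: rI_ext If => t _; rewrite fg//; exists t.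
Qed.

Lemma normcD2 (x y : C) :
  normc (x + y) ^+ 2 <= 2 * normc x ^+ 2 + 2 * normc y ^+ 2.
Proof.
rewrite !normc2E; case: x y => [a c] [b d] /=.
rewrite -subr_ge0 (_ : _ - _ = (a - b) ^+ 2 + (c - d) ^+ 2); last by ring.
by rewrite addr_ge0// sqr_ge0.
Qed.

Lemma L2D f g : L2 f -> L2 g -> L2 (fun z => f z + g z).
Proof.
move=> [mf If] [mg Ig].
apply: (@L2_dom _ (fun t => 2 * normc (f (circ t)) ^+ 2 + 2 * normc (g (circ t)) ^+ 2)).
- exact: cmeasD.
- by apply: rID; exact: rIZ.
- by move=> t _; exact: normcD2.
Qed.

Lemma L2Z (k : C) f : L2 f -> L2 (fun z => k * f z).
Proof.
move=> [mf If].
apply: (@L2_dom _ (fun t => normc k ^+ 2 * normc (f (circ t)) ^+ 2)).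
- by apply: cmeasM => //; exact: cmeas_cst.
- exact: rIZ.
- by move=> t _; rewrite normcM exprMn.
Qed.

Lemma L2_lin (c : C) f g : L2 f -> L2 g -> L2 (fun z => c * f z + g z).
Proof. by move=> Lf Lg; apply: L2D => //; exact: L2Z. Qed.

Lemma L2B f g : L2 f -> L2 g -> L2 (fun z => f z - g z).
Proof.
move=> Lf Lg; apply: (@L2_ext (fun z => -1 * g z + f z)); last exact: L2_lin.
by move=> z _; rewrite mulN1r addrC.
Qed.

Lemma L2J f : L2 f -> L2 (fun z => (f z)^*).
Proof.
move=> [mf If]; split; first exact: cmeasJ.
by apply: rI_ext If => t _; rewrite normcJE.
Qed.

Lemma L2_cst (c : C) : L2 (fun=> c).
Proof. by split; [exact: cmeas_cst|exact: rI_cst]. Qed.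

Lemma L2_aeq f g : L2 f -> cmeasurable g -> aeq f g -> L2 g.
Proof.
move=> [mf If] mg fg; split => //.
have [] // := rI_aeq (cmeas_norm2 mg) _ If.
by apply: filterS fg => t h /h /= ->.
Qed.

Lemma L2_mul f g : L2 f -> L2 g -> cintegrable (fun z => f z * g z).
Proof.
move=> [mf If] [mg Ig].
apply: (@CI_dom _ _ (fun t => normc (f (circ t)) ^+ 2 + normc (g (circ t)) ^+ 2)).
- exact: cmeasM.
- exact: rID.
- move=> t _; rewrite normcM.
  have := normc_ge0 (f (circ t)); have := normc_ge0 (g (circ t)).
  by move: (normc _) (normc _) => x y; nra.
Qed.

Lemma L2_CIdot f g : L2 f -> L2 g -> cintegrable (fun z => f z * (g z)^*).
Proof. by move=> Lf Lg; apply: L2_mul => //; exact: L2J. Qed.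

Lemma L2_CI f : L2 f -> cintegrable f.
Proof.
move=> Lf; apply: CI_ext (L2_mul Lf (L2_cst 1)) => z _; exact: mulr1.
Qed.

Lemma L2_bmul b f : Linf b -> L2 f -> L2 (fun z => b z * f z).
Proof.
move=> [mb [M bM]] [mf If].
(* The bound [M] holds only almost everywhere, while [L2_dom] asks for a bound at every point of
   [arc]; so [b] is replaced by 0 where it exceeds [M]. *)
pose b' z := if normc (b z) <= M then b z else 0.
have mb' : measurable_fun arc (fun t => normc (b (circ t)) <= M).
  have := cmeas_norm mb => m.
  by apply: measurable_fun_ler => //; exact: measurable_cst.
have cb' : cmeasurable b'.
  case: mb => [m1 m2]; split; rewrite /b'.
    have -> : (fun t => complex.Re (if normc (b (circ t)) <= M then b (circ t) else 0))
      = (fun t => if normc (b (circ t)) <= M then complex.Re (b (circ t)) else 0).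
      by apply/funext => t; case: ifP.
    apply: measurable_fun_if; [exact: measurable_itv|exact: mb'| |].
      by refine (measurable_funS _ _ m1); [exact: measurable_itv|exact: subIsetl].
    exact: measurable_cst.
  have -> : (fun t => complex.Im (if normc (b (circ t)) <= M then b (circ t) else 0))
      = (fun t => if normc (b (circ t)) <= M then complex.Im (b (circ t)) else 0).
    by apply/funext => t; case: ifP.
  apply: measurable_fun_if; [exact: measurable_itv|exact: mb'| |].
      by refine (measurable_funS _ _ m2); [exact: measurable_itv|exact: subIsetl].
    exact: measurable_cst.
have bb' : aeq b' b.
  by apply: (aeS bM) => t h /h /=; rewrite /b' => ->.
apply: (@L2_aeq (fun z => b' z * f z)); last 2 first.
- exact: cmeasM.
- by apply: (aeq_mono bb') => z _ ->.
apply: (@L2_dom _ (fun t => M ^+ 2 * normc (f (circ t)) ^+ 2)).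
- exact: cmeasM.
- exact: rIZ.
- move=> t _; rewrite normcM exprMn ler_wpM2r ?sqr_ge0// /b'; case: ifP => h.
    by rewrite lerXn2r// ?nnegrE ?normc_ge0// (le_trans _ h)// normc_ge0.
  by rewrite normc0 expr0n/= sqr_ge0.
Qed.

Lemma Linf_cst (c : C) : Linf (fun=> c).
Proof. by split; [exact: cmeas_cst|exists (normc c); exact: aeW]. Qed.

Lemma Linf_zpow n : Linf (zpow n : C -> C).
Proof.
split; first exact: cmeas_zpow.
by exists 1; apply: aeW => t _; rewrite zpow_circ normc_circ.
Qed.

Lemma LinfM b1 b2 : Linf b1 -> Linf b2 -> Linf (fun z => b1 z * b2 z).
Proof.
move=> [m1 [M1 h1]] [m2 [M2 h2]]; split; first exact: cmeasM.
exists (M1 * M2); apply: (aeS2 h1 h2) => t a1 a2 at_; rewrite normcM.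
by apply: ler_pM; rewrite ?normc_ge0 ?a1 ?a2.
Qed.

Lemma LinfD b1 b2 : Linf b1 -> Linf b2 -> Linf (fun z => b1 z + b2 z).
Proof.
move=> [m1 [M1 h1]] [m2 [M2 h2]]; split; first exact: cmeasD.
exists (M1 + M2); apply: (aeS2 h1 h2) => t a1 a2 at_.
by rewrite (le_trans (le_normcD _ _))// lerD ?a1 ?a2.
Qed.

Lemma LinfJ b : Linf b -> Linf (fun z => (b z)^*).
Proof.
move=> [m [M h]]; split; first exact: cmeasJ.
by exists M; apply: (aeS h) => t a at_; rewrite normcJE a.
Qed.

Lemma Linf_L2 b : Linf b -> L2 b.
Proof.
move=> h; apply: L2_ext (L2_bmul h (L2_cst 1)) => z _; exact: mulr1.
Qed.

Lemma L2_zpow n : L2 (zpow n : C -> C).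
Proof. exact/Linf_L2/Linf_zpow. Qed.

Lemma CI_bmul b f : Linf b -> cintegrable f -> cintegrable (fun z => b z * f z).
Proof.
move=> [mb [M bM]] If; have mf := CI_cmeas If.
have m : cmeasurable (fun z => b z * f z) by exact: cmeasM.
apply: CI_norml => //; apply/integrableP; split.
  by apply/measurable_EFinP; exact: (cmeas_norm m).
have /integrableP [_ h] : rintegrable (fun t => `|M| * normc (f (circ t))).
  exact/rIZ/CI_norm.
apply: le_lt_trans h; apply: ae_ge0_le_integral => //.
- by apply/measurableT_comp => //; apply/measurable_EFinP; exact: (cmeas_norm m).
- apply/measurableT_comp => //; apply/measurable_EFinP.
  by apply: measurable_funM; [exact: measurable_cst|exact: cmeas_norm].
- apply: (aeS bM) => t h /h bt /=; rewrite lee_fin !normrM normr_id normcM.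
  rewrite normrM ler_wpM2r// ger0_norm ?normc_ge0//.
  by rewrite (le_trans bt)// ler_norm.
Qed.

Lemma L2dot_ext f g f' g' :
  (forall z, on_circle z -> f z * (g z)^* = f' z * (g' z)^*) ->
  L2dot f g = L2dot f' g'.
Proof. by move=> h; exact: cint_ext. Qed.

Lemma L2dot_aeq f g f' g' : L2 f -> L2 g -> L2 f' -> L2 g' ->
  aeq f f' -> aeq g g' -> L2dot f g = L2dot f' g'.
Proof.
move=> Lf Lg Lf' Lg' ff' gg'.
apply: (cint_aeq (L2_CIdot Lf Lg) _ _).2; first exact/CI_cmeas/L2_CIdot.
by apply: (aeq_mono2 ff' gg') => z _ -> ->.
Qed.

Lemma L2dot_lin (c : C) f g h : L2 f -> L2 g -> L2 h ->
  L2dot (fun z => c * f z + g z) h = c * L2dot f h + L2dot g h.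
Proof.
move=> Lf Lg Lh; rewrite /L2dot.
rewrite (@cint_ext _ _ (fun z => c * (f z * (h z)^*) + g z * (h z)^*)).
  by rewrite cintD ?cintZ//; [exact: L2_CIdot|exact/CIZ/L2_CIdot|exact: L2_CIdot].
by move=> z _; ring.
Qed.

Lemma L2dotC f g : L2 f -> L2 g -> L2dot g f = (L2dot f g)^*.
Proof.
move=> Lf Lg; rewrite /L2dot -cintJ; last exact: L2_CIdot.
by apply: cint_ext => z _; rewrite cJM cJK mulrC.
Qed.

Lemma L2dotD f g h : L2 f -> L2 g -> L2 h ->
  L2dot (fun z => f z + g z) h = L2dot f h + L2dot g h.
Proof.
move=> Lf Lg Lh; rewrite -[L2dot f h]mul1r -L2dot_lin//.
by apply: L2dot_ext => z _; rewrite mul1r.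
Qed.

Lemma L2dotZ (c : C) f h : L2 f -> L2 h ->
  L2dot (fun z => c * f z) h = c * L2dot f h.
Proof.
move=> Lf Lh; rewrite /L2dot -cintZ; last exact: L2_CIdot.
by apply: cint_ext => z _; rewrite mulrA.
Qed.

Lemma L2dotB f g h : L2 f -> L2 g -> L2 h ->
  L2dot (fun z => f z - g z) h = L2dot f h - L2dot g h.
Proof.
move=> Lf Lg Lh; rewrite -mulN1r addrC -L2dot_lin//.
by apply: L2dot_ext => z _; rewrite mulN1r addrC.
Qed.

Lemma L2dotZr (c : C) f h : L2 f -> L2 h ->
  L2dot f (fun z => c * h z) = c^* * L2dot f h.
Proof.
move=> Lf Lh; rewrite /L2dot -cintZ; last exact: L2_CIdot.
by apply: cint_ext => z _; rewrite cJM; ring.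
Qed.

Lemma L2dotDr f g h : L2 f -> L2 g -> L2 h ->
  L2dot f (fun z => g z + h z) = L2dot f g + L2dot f h.
Proof.
move=> Lf Lg Lh; rewrite L2dotC ?L2dotD//; last exact: L2D.
by rewrite cJD -!L2dotC.
Qed.

Lemma L2dotBr f g h : L2 f -> L2 g -> L2 h ->
  L2dot f (fun z => g z - h z) = L2dot f g - L2dot f h.
Proof.
move=> Lf Lg Lh; rewrite L2dotC ?L2dotB//; last exact: L2B.
by rewrite cJB -!L2dotC.
Qed.

Lemma L2dot0 h : L2dot (fun=> 0) h = 0.
Proof.
rewrite /L2dot (@cint_ext _ _ (fun=> 0 * 0)).
  by rewrite cintZ ?mul0r//; exact: CI_cst.
by move=> z _; rewrite !mul0r.
Qed.

Lemma nrm2_ge0 f : 0 <= nrm2 f.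
Proof. by apply: Rintegral_ge0 => t _; exact: sqr_ge0. Qed.

Lemma L2dotff f : L2dot f f = (nrm2 f)%:C.
Proof.
apply: complex_eqP => /=.
  by apply: eq_Rintegral => t _; rewrite mulcJ.
rewrite (@rint_ext _ _ (fun=> 0)) ?Rintegral_cst ?mul0r//.
by move=> t _; rewrite mulcJ.
Qed.

Lemma nrm2_aeq f g : L2 f -> L2 g -> aeq f g -> nrm2 f = nrm2 g.
Proof.
move=> Lf Lg fg; apply: complexI; rewrite -!L2dotff; exact: L2dot_aeq.
Qed.

Lemma nrm2_eq0 f : L2 f -> nrm2 f = 0 -> aeq f (fun=> 0).
Proof.
move=> [mf If] f0.
have m : measurable_fun arc (fun t => (normc (f (circ t)) ^+ 2)%:E).
  by apply/measurable_EFinP; exact: cmeas_norm2.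
have /(ae_eq_integral_abs mu measurable_arc m) h :
    (\int[mu]_(t in arc) `|(normc (f (circ t)) ^+ 2)%:E| = 0)%E.
  under eq_integral do rewrite gee0_abs ?lee_fin ?sqr_ge0//.
  have fin := integrable_fin_num measurable_arc If.
  by rewrite -(fineK fin); congr EFin; exact: f0.
apply: filterS h => t h /h [] /eqP; rewrite sqrf_eq0 => /eqP.
exact: eq0_normc.
Qed.

Lemma L2normE f : L2norm f = Num.sqrt (nrm2 f).
Proof. by []. Qed.

Lemma nrm2_lin (a : R) f g : L2 f -> L2 g ->
  nrm2 (fun z => a%:C * f z + g z) =
  a ^+ 2 * nrm2 f + 2 * a * complex.Re (L2dot f g) + nrm2 g.
Proof.
move=> Lf Lg; have Laf : L2 (fun z => a%:C * f z) by exact: L2Z.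
apply: complexI; rewrite -L2dotff L2dot_lin//; last exact: L2_lin.
rewrite !L2dotDr// !L2dotZr// !L2dotff (L2dotC Lf Lg).
case: (L2dot f g) => x y.
by apply: complex_eqP; rewrite !(RecD,ImcD,RecM,ImcM,RecJ,ImcJ)/=; ring.
Qed.

Lemma nrm2Z (c : C) f : L2 f -> nrm2 (fun z => c * f z) = normc c ^+ 2 * nrm2 f.
Proof.
move=> Lf; apply: complexI; rewrite -L2dotff L2dotZ ?L2dotZr//; last exact: L2Z.
by rewrite mulrA mulcJ L2dotff -real_complexM.
Qed.

(** A nonnegative quadratic has nonpositive discriminant. It serves Cauchy-Schwarz and also the
    estimate of an almost minimizer in [riesz_real]. *)
Lemma discr_le (a b c : R) : 0 <= a -> (forall s : R, 0 <= a * s ^+ 2 + 2 * b * s + c) ->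
  b ^+ 2 <= a * c.
Proof.
move=> a0 h; have [a_eq0|an0] := eqVneq a 0.
  rewrite a_eq0 mul0r.
  have [->|bn0] := eqVneq b 0; first by rewrite expr0n.
  (* At this point the affine function [2 * b * s + c] takes the value -1. *)
  have := h (- (c + 1) / (2 * b)); rewrite a_eq0 mul0r add0r.
  by rewrite mulrC divfK ?mulf_neq0//; lra.
have ap : 0 < a by rewrite lt_def an0.
have := h (- b / a).
rewrite -(ler_pM2l ap) mulr0 => /le_trans; rewrite -subr_ge0.
have -> : a * (a * (- b / a) ^+ 2 + 2 * b * (- b / a) + c) = a * c - b ^+ 2.
  by field.
by move=> /(_ _ (lexx _)).
Qed.

Lemma cauchy_schwarz_re f g : L2 f -> L2 g ->
  complex.Re (L2dot f g) ^+ 2 <= nrm2 f * nrm2 g.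
Proof.
move=> Lf Lg; apply: discr_le; first exact: nrm2_ge0.
move=> s; have := nrm2_ge0 (fun z => s%:C * f z + g z).
by rewrite nrm2_lin//; lra.
Qed.

Lemma cauchy_schwarz f g : L2 f -> L2 g -> normc (L2dot f g) ^+ 2 <= nrm2 f * nrm2 g.
Proof.
move=> Lf Lg; set w := L2dot f g.
have [w0|wn0] := eqVneq w 0.
  by rewrite w0 normc0 expr0n/= mulr_ge0// nrm2_ge0.
have Nw : 0 < normc w ^+ 2.
  rewrite exprn_gt0// lt_def normc_ge0 andbT; apply: contra_neq wn0.
  exact: eq0_normc.
(* Multiplying [f] by the conjugate of [w] makes the inner product real, equal to [|w|^2]; the real
   inequality then carries a common factor [|w|^2] to cancel. *)
have := cauchy_schwarz_re (L2Z w^* Lf) Lg; rewrite L2dotZ// nrm2Z// normcJE -/w.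
rewrite (_ : complex.Re (w^* * w) = normc w ^+ 2); last by rewrite mulrC mulcJ.
by move: (normc w ^+ 2) Nw => N Nw h; rewrite -(ler_pM2l Nw); lra.
Qed.

Lemma aeq_dot_eq f g : L2 f -> L2 g ->
  (forall h, L2 h -> L2dot f h = L2dot g h) -> aeq f g.
Proof.
move=> Lf Lg fg; have Ld := L2B Lf Lg.
have /(nrm2_eq0 Ld) h : nrm2 (fun z => f z - g z) = 0.
  by apply: complexI; rewrite -L2dotff L2dotB// fg// subrr.
apply: (aeq_mono h) => z _ /eqP; rewrite subr_eq0 => /eqP; exact.
Qed.

End L2space.

(** * Completeness of L^2 *)

Section Completeness.
Context {R : realType}.
Local Notation C := R[i].
Local Notation mu := (@lebesgue_measure R).
Local Notation arc := (@Defs.arc R).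

Lemma cvg_of_summable_increments (u : nat -> R) (d : nat -> R) :
  (forall n, `|u n.+1 - u n| <= d n) ->
  (\sum_(0 <= n <oo) (d n)%:E < +oo)%E -> cvgn u.
Proof.
move=> ud d_fin.
have d_ge0 n : 0 <= d n by rewrite (le_trans _ (ud n)).
have sd : cvgn (series d).
  apply: nondecreasing_is_cvgn.
    by apply: nondecreasing_series => n _ _.
  exists (fine (\sum_(0 <= n <oo) (d n)%:E)) => _ [n _ <-].
  have fin : (\sum_(0 <= n <oo) (d n)%:E)%E \is a fin_num.
    by rewrite ge0_fin_numE// nneseries_ge0// => k _ _; rewrite lee_fin.
  rewrite -lee_fin fineK// /series /= -sumEFin.
  by apply: nneseries_lim_ge => k _ _; rewrite lee_fin.
have su : cvgn (series (telescope u)).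
  apply: normed_cvg; apply: (series_le_cvg _ d_ge0 _ sd) => n /=; first exact: normr_ge0.
  exact: ud.
rewrite (_ : u = (fun n => u 0%N + series (telescope u) n)); last first.
  by apply/funext => n; rewrite -eq_sum_telescope.
by apply: is_cvgD => //; exact: is_cvg_cst.
Qed.

Lemma limn_einf_le (u : (\bar R)^nat) (c : \bar R) :
  (forall n, u n <= c)%E -> (limn_einf u <= c)%E.
Proof.
move=> uc; rewrite limn_einf_lim; apply: lime_le; first exact: is_cvg_einfs.
by apply: nearW => n; apply: le_trans (uc n); apply: ereal_inf_lbound; exists n => /=.
Qed.

Lemma cmeas_limn (f_ : nat -> C -> C) : (forall n, cmeasurable (f_ n)) ->
  cmeasurable (fun z => fine (limn_esup (fun n => (complex.Re (f_ n z))%:E)) +i*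
    fine (limn_esup (fun n => (complex.Im (f_ n z))%:E))).
Proof.
move=> mf; split.
  apply: (measurableT_comp (@fine_measurable R setT measurableT)).
  apply: (@measurable_fun_limn_esup _ _ _ _
    (fun n t => (complex.Re (f_ n (circ t)))%:E)) => n.
  by apply/measurable_EFinP; exact: (mf n).1.
apply: (measurableT_comp (@fine_measurable R setT measurableT)).
apply: (@measurable_fun_limn_esup _ _ _ _
    (fun n t => (complex.Im (f_ n (circ t)))%:E)) => n.
by apply/measurable_EFinP; exact: (mf n).2.
Qed.

(** Riesz-Fischer with a prescribed rate: distances at most [2^-n] are summable, so no subsequence
    is extracted. The increments sum in L^1, which gives convergence almost everywhere, and Fatou's
    lemma carries the rate over to the limit. *)
Lemma L2_complete (f_ : nat -> C -> C) : (forall n, L2 (f_ n)) ->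
  (forall n m, (n <= m)%N ->
    nrm2 (fun z => f_ n z - f_ m z) <= (4^-1) ^+ n) ->
  exists2 f, L2 f & forall n, nrm2 (fun z => f_ n z - f z) <= (4^-1) ^+ n.
Proof.
move=> Lf cauchy.
pose d n (t : R) := normc (f_ n.+1 (circ t) - f_ n (circ t)).
have Ld n : L2 (fun z => f_ n.+1 z - f_ n z) by exact: L2B.
have Id n : rintegrable (d n) by exact: (CI_norm (L2_CI (Ld n))).
have d0 n t : 0 <= d n t by exact: normc_ge0.
(* The bound is [2^-n], written in the form that [epsilon_trick0] sums to 2. *)
have int_d n : (\int[mu]_(t in arc) (d n t)%:E <= (2 / (2 ^ n.+1)%:R)%:E)%E.
  have fin := integrable_fin_num measurable_arc (Id n).
  rewrite -(fineK fin) lee_fin.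
  have -> : 2 / (2 ^ n.+1)%:R = 2^-1 ^+ n :> R.
    by rewrite natrX exprS invfM mulVKf// exprVn.
  have := cauchy n n.+1 (leqnSn n).
  move=> h.
  have Id2 := L2_rI (Ld n).
  have {}h : nrm2 (fun z => f_ n.+1 z - f_ n z) <= (4^-1) ^+ n.
    apply: le_trans h; rewrite le_eqVlt; apply/orP; left; apply/eqP.
    apply: rint_ext => t _; rewrite -[X in normc X]opprB.
    by case: (f_ n _ - _) => x y /=; rewrite !sqrrN.
  (* From L^2 to L^1: [2 x c <= x^2 + c^2] at [c = 2^-n], divided by [2 c]. *)
  apply: (@le_trans _ _ (\int[mu]_(t in arc)
      ((2 ^+ n / 2) * d n t ^+ 2 + (2^-1 ^+ n / 2)))).
    apply: le_Rintegral => //; first exact: Id.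
      by apply: rID; [exact: rIZ|exact: rI_cst].
    move=> t _; move: (d n t) => x; rewrite -subr_ge0.
    rewrite (_ : _ - _ = 2 ^+ n / 2 * (x - 2^-1 ^+ n) ^+ 2).
      by rewrite mulr_ge0 ?sqr_ge0// divr_ge0// exprn_ge0.
    have p : (2 ^+ n : R) != 0 by rewrite expf_neq0.
    by rewrite exprVn; field.
  rewrite RintegralD//; [|exact: rIZ|exact: rI_cst].
  rewrite RintegralZl// Rintegral_cst//.
  have -> : fine (mu arc) = 1 by rewrite mu_arc.
  have {}h : \int[mu]_(x in arc) d n x ^+ 2 <= (2^-1 ^+ n) ^+ 2.
    by rewrite -exprM mulnC exprM expr2 -invfM -natrM.
  move: h; move: (\int[mu]_(x in arc) d n x ^+ 2) => I h.
  have p : (2 ^+ n : R) != 0 by rewrite expf_neq0.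
  have q : (0 : R) < 2 ^+ n by rewrite exprn_gt0.
  apply: (@le_trans _ _ (2 ^+ n / 2 * (2^-1 ^+ n) ^+ 2 + 2^-1 ^+ n / 2 * 1)).
    by rewrite lerD2r ler_wpM2l// divr_ge0// ltW.
  by rewrite exprVn le_eqVlt; apply/orP; left; apply/eqP; field.
pose S (t : R) := (\sum_(0 <= n <oo) (d n t)%:E)%E.
have md n : measurable_fun arc (fun t => (d n t)%:E).
  by apply/measurable_EFinP; exact: rI_meas.
have IS : (\int[mu]_(t in arc) S t <= 2%:E)%E.
  rewrite integral_nneseries//; last by move=> n t _; rewrite lee_fin.
  apply: le_trans (epsilon_trick0 xpredT (ler0n R 2)).
  apply: lee_nneseries => // n _ _.
  by apply: integral_ge0 => t _; rewrite lee_fin.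
have mS : measurable_fun arc S.
  by apply: ge0_emeasurable_sum => // n t _ _; rewrite lee_fin.
have S0 t : (0 <= S t)%E by apply: nneseries_ge0 => n _ _; rewrite lee_fin.
have iS : mu.-integrable arc S.
  apply/integrableP; split => //.
  under eq_integral do rewrite gee0_abs//.
  by apply: le_lt_trans IS _; rewrite ltry.
have fS := integrable_ae measurable_arc iS.
(* A limsup is measurable whether or not the sequence converges; [fine] gives some real value at the
   points of divergence, which form a null set. *)
pose f z := fine (limn_esup (fun n => (complex.Re (f_ n z))%:E)) +i*
    fine (limn_esup (fun n => (complex.Im (f_ n z))%:E)).
have mf : cmeasurable f by apply: cmeas_limn => n; exact: L2_cmeas.
have f_f : {ae mu, forall t, arc t ->
    complex.Re (f_ n (circ t)) @[n --> \oo] --> complex.Re (f (circ t)) /\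
    complex.Im (f_ n (circ t)) @[n --> \oo] --> complex.Im (f (circ t))}.
  apply: (aeS fS) => t h /h; rewrite ge0_fin_numE// => Sfin.
  have key (u : nat -> R) : (forall n, `|u n.+1 - u n| <= d n t) ->
      u n @[n --> \oo] --> fine (limn_esup (fun n => (u n)%:E)).
    move=> /cvg_of_summable_increments /(_ Sfin) cu.
    rewrite (_ : limn_esup _ = (limn u)%:E)//.
    by apply: (cvg_limn_einf_sup _).2; apply: cvg_EFin => //; exact: nearW.
  split; apply: key => n; rewrite /d.
    by apply: le_trans (normRe _); case: (f_ n.+1 _) (f_ n _) => [a b] [a' b'].
  by apply: le_trans (normIm _); case: (f_ n.+1 _) (f_ n _) => [a b] [a' b'].
have key n : (\int[mu]_(t in arc) (normc (f_ n (circ t) - f (circ t)) ^+ 2)%:E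
    <= ((4^-1) ^+ n)%:E)%E.
  (* Indexing by [n + m] makes the Cauchy bound hold for every [m], hence for the lower limit that
     Fatou's lemma produces. *)
  pose h m (t : R) := (normc (f_ n (circ t) - f_ (n + m)%N (circ t)) ^+ 2)%:E.
  have mh m : measurable_fun arc (h m).
    by apply/measurable_EFinP; apply: (cmeas_norm2 (f := fun z => f_ n z - f_ (n + m)%N z));
      apply/L2_cmeas/L2B.
  have h0 m t : arc t -> (0 <= h m t)%E by move=> _; rewrite lee_fin sqr_ge0.
  have le1 : (limn_einf (fun m => \int[mu]_(t in arc) h m t) <= ((4^-1) ^+ n)%:E)%E.
    apply: limn_einf_le => m.
    have Inm := L2_rI (L2B (Lf n) (Lf (n + m)%N)).
    have fin := integrable_fin_num measurable_arc Inm.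
    rewrite -(fineK fin) lee_fin; exact: (cauchy n (n + m)%N (leq_addr _ _)).
  apply: le_trans le1; apply: le_trans (fatou mu measurable_arc mh h0).
  have cfn : cmeasurable (fun z => f_ n z - f z).
    apply: (@cmeas_ext _ (fun z => f_ n z + -1 * f z)).
      by move=> z _; rewrite mulN1r.
    apply: cmeasD; first exact: L2_cmeas.
    by apply: cmeasM => //; exact: cmeas_cst.
  have lim_h : {ae mu, forall t, arc t ->
      h m t @[m --> \oo] --> (normc (f_ n (circ t) - f (circ t)) ^+ 2)%:E}.
    apply: (aeS f_f) => t cv /cv [cr ci].
    rewrite /h; apply: cvg_EFin; first exact: nearW.
    rewrite /comp /=.
    under eq_fun do rewrite normc2E.
    rewrite normc2E.
    have shift (u : nat -> R) (l : R) : u m @[m --> \oo] --> l ->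
      u (n + m)%N @[m --> \oo] --> l.
      by move=> ul; apply: (cvg_comp _ _ (cvg_addnl n) ul).
    have cr' : complex.Re (f_ n (circ t) - f_ (n + m)%N (circ t)) @[m --> \oo] -->
        complex.Re (f_ n (circ t) - f (circ t)).
      rewrite (_ : complex.Re (_ - f _) = complex.Re (f_ n (circ t)) - complex.Re (f (circ t))).
        rewrite (_ : (fun m => _) = (fun m => complex.Re (f_ n (circ t)) -
             complex.Re (f_ (n + m)%N (circ t)))).
          by apply: cvgB; [exact: cvg_cst|exact: (shift (fun n => complex.Re (f_ n (circ t))))].
        by apply/funext => m; case: (f_ n _) (f_ (n + m)%N _) => [a b] [a' b'].
      by case: (f_ n _) (f _) => [a b] [a' b'].
    have ci' : complex.Im (f_ n (circ t) - f_ (n + m)%N (circ t)) @[m --> \oo] -->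
        complex.Im (f_ n (circ t) - f (circ t)).
      rewrite (_ : complex.Im (_ - f _) = complex.Im (f_ n (circ t)) - complex.Im (f (circ t))).
        rewrite (_ : (fun m => _) = (fun m => complex.Im (f_ n (circ t)) -
             complex.Im (f_ (n + m)%N (circ t)))).
          by apply: cvgB; [exact: cvg_cst|exact: (shift (fun n => complex.Im (f_ n (circ t))))].
        by apply/funext => m; case: (f_ n _) (f_ (n + m)%N _) => [a b] [a' b'].
      by case: (f_ n _) (f _) => [a b] [a' b'].
    by apply: cvgD; rewrite !expr2; apply: cvgM.
  apply: ae_ge0_le_integral => //.
  - by move=> t _; rewrite lee_fin sqr_ge0.
  - by apply/measurable_EFinP; exact: (cmeas_norm2 cfn).
  - move=> t At; rewrite limn_einf_lim; apply: lime_ge; first exact: is_cvg_einfs.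
    by apply: nearW => m; apply: le_ereal_inf_tmp => _ [k _ <-]; exact: h0.
  - rewrite (_ : (fun t => _) = (fun t => - limn_esup (fun m => - h m t))%E)//.
    apply: measurableT_comp => //.
    apply: (@measurable_fun_limn_esup _ _ _ _ (fun m t => (- h m t)%E)) => m.
    by apply: measurableT_comp => //; exact: mh.
  - by apply: (aeS lim_h) => t cv /cv /cvg_limn_einf_sup [-> _].
have Ifn n : rintegrable (fun t => normc (f_ n (circ t) - f (circ t)) ^+ 2).
  apply/integrableP; split.
    apply/measurable_EFinP; apply: (cmeas_norm2 (f := fun z => f_ n z - f z)).
    apply: (@cmeas_ext _ (fun z => f_ n z + -1 * f z)).
      by move=> z _; rewrite mulN1r.
    apply: cmeasD; first exact: L2_cmeas.
    by apply: cmeasM => //; exact: cmeas_cst.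
  under eq_integral do rewrite /= ger0_norm ?sqr_ge0//.
  by apply: le_lt_trans (key n) _; rewrite ltry.
exists f.
  apply: (@L2_dom _ _ (fun t => 2 * normc (f_ 0%N (circ t) - f (circ t)) ^+ 2
     + 2 * normc (f_ 0%N (circ t)) ^+ 2)) => //.
    by apply: rID; apply: rIZ => //; exact: L2_rI.
  move=> t _; have := normcD2 (f (circ t) - f_ 0%N (circ t)) (f_ 0%N (circ t)).
  by rewrite subrK -[X in _ <= 2 * normc X ^+ 2 + _]opprB normcN.
move=> n; have fin := integrable_fin_num measurable_arc (Ifn n).
by rewrite -lee_fin; apply: le_trans (key n); rewrite -(fineK fin).
Qed.

End Completeness.

(** * Riesz representation *)

Section Riesz.
Context {R : realType}.
Local Notation C := R[i].
Implicit Types (f g h : C -> C) (S : set (C -> C)).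

(* The closed subspaces of L^2, given as orthogonal complements. *)
Definition orthc S : set (C -> C) :=
  [set f | L2 f /\ forall h, S h -> L2dot f h = 0].

Lemma le0_of_le_geometric (x c : R) :
  (forall n : nat, x <= c * (4^-1) ^+ n) -> x <= 0.
Proof.
move=> xc.
have cv : geometric c (4^-1) @ \oo --> (0 : R).
  by apply: cvg_geometric; rewrite gtr0_norm ?invr_gt0// invf_lt1// ltr1n.
rewrite -(cvg_lim _ cv)//; apply: limr_ge; first by apply/cvg_ex; exists 0.
by apply: nearW.
Qed.

Lemma orthc_lin S (c : C) f g : S `<=` L2 -> orthc S f -> orthc S g ->
  orthc S (fun z => c * f z + g z).
Proof.
move=> SL [Lf f0] [Lg g0]; split; first exact: L2_lin.
by move=> h Sh; rewrite L2dot_lin ?f0 ?g0 ?mulr0 ?addr0//; exact: SL.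
Qed.

Lemma orthc0 S : orthc S (fun=> 0).
Proof. by split; [exact: L2_cst|move=> h _; exact: L2dot0]. Qed.

Lemma orthcZ S (c : C) f : S `<=` L2 -> orthc S f -> orthc S (fun z => c * f z).
Proof.
move=> SL Kf; rewrite (_ : (fun z => _) = (fun z => c * f z + (fun=> 0) z)).
  by apply: orthc_lin => //; exact: orthc0.
by apply/funext => z; rewrite addr0.
Qed.

(** Dirichlet's principle: if [l] is the real part of the pairing with [x], then
    [J f = |f - x|^2 - |x|^2], so [x] has to minimize [J] on the subspace. Boundedness of [l] bounds
    [J] below, and the parallelogram identity makes a minimizing sequence Cauchy. *)
Lemma riesz_real S (l : (C -> C) -> R) (M : R) : S `<=` L2 -> 0 <= M ->
  (forall (a : R) f g, orthc S f -> orthc S g ->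
    l (fun z => a%:C * f z + g z) = a * l f + l g) ->
  (forall f, orthc S f -> l f ^+ 2 <= M * nrm2 f) ->
  exists2 x, orthc S x & forall h, orthc S h -> complex.Re (L2dot x h) = l h.
Proof.
move=> SL M0 lin bnd.
pose J f := nrm2 f - 2 * l f.
(* The expansion of [J] along a line; [s = 1] and [s = 1/2] give the parallelogram identity, and a
   free [s] gives the Euler equation. *)
have JE (s : R) h x : orthc S h -> orthc S x ->
    J (fun z => s%:C * h z + x z) =
    J x + 2 * s * (complex.Re (L2dot x h) - l h) + s ^+ 2 * nrm2 h.
  move=> Kh Kx; have [Lh _] := Kh; have [Lx _] := Kx.
  rewrite /J nrm2_lin// lin// (L2dotC Lx Lh) RecJ.
  ring.
pose E := [set J f | f in orthc S].
have Elb : lbound E (- M).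
  move=> _ [f Kf <-]; rewrite /J.
  have := bnd f Kf; have := nrm2_ge0 f.
  move: (nrm2 f) (l f) => N u N0 h; rewrite leNgt; apply/negP => lt.
  (* This contradicts [u^2 <= M N], because [4 M N <= (M + N)^2]. *)
  have : (M + N) ^+ 2 < (2 * u) ^+ 2.
    by rewrite ltrXn2r// ?nnegrE; lra.
  have : 0 <= (M - N) ^+ 2 by exact: sqr_ge0.
  by rewrite !expr2 in h *; lra.
have Einf : has_inf E.
  by split; [exists (J (fun=> 0)), (fun=> 0) => //; exact: orthc0|exists (- M)].
pose m := inf E.
have mJ f : orthc S f -> m <= J f.
  by move=> Kf; apply: ge_inf; [exists (- M)|exists f].
(* An excess of [4^-n / 4] over the infimum bounds the squared distance of [x_ n] and [x_ p] by
   [(4^-n + 4^-p) / 2], which meets the rate [4^-n] of [L2_complete] when [n <= p]. *)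
have p4 n : 0 < ((4^-1) ^+ n / 4 : R).
  by rewrite divr_gt0// exprn_gt0.
have /choice [x_ xP] : forall n : nat, exists x,
    orthc S x /\ J x < m + (4^-1) ^+ n / 4.
  by move=> n; have [_ [x Kx <-] h] := inf_adherent (p4 n) Einf; exists x.
have Kx n : orthc S (x_ n) by have [] := xP n.
have Lx n : L2 (x_ n) by have [] := Kx n.
have Jx n : J (x_ n) < m + (4^-1) ^+ n / 4 by have [] := xP n.
have [n p np|x Lx0 xx] := L2_complete Lx.
  pose h z := (-1)%:C * x_ n z + x_ p z.
  have Kh : orthc S h by exact: orthc_lin.
  have := JE 1 h (x_ n) Kh (Kx n).
  have -> : (fun z => 1%:C * h z + x_ n z) = x_ p.
    by apply/funext => z; rewrite /h rmorphN mulN1r mul1r addrAC addNr add0r.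
  (* The midpoint of [x_ n] and [x_ p], where [J] is still at least [m]. *)
  have Kmid : orthc S (fun z => (2^-1)%:C * h z + x_ n z) by exact: orthc_lin.
  have := mJ _ Kmid; rewrite JE//.
  have -> : nrm2 (fun z => x_ n z - x_ p z) = nrm2 h.
    apply: rint_ext => t _; rewrite -normcN; congr (normc _ ^+ 2).
    by rewrite /h rmorphN mulN1r opprB addrC.
  have := Jx n; have := Jx p.
  have : (4^-1) ^+ p <= (4^-1) ^+ n :> R.
    by rewrite ler_wiXn2l// invf_le1// ler1n.
  move: (J _) (J (x_ p)) (nrm2 h) (complex.Re _ - _) ((4^-1) ^+ p) => a b c e f.
  move: ((4^-1) ^+ n) => g.
  rewrite exprVn; lra.
have Kx0 : orthc S x.
  split => // h Sh; have Lh := SL _ Sh.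
  apply: eq0_normc; apply/eqP; rewrite -sqrf_eq0 eq_le sqr_ge0 andbT.
  apply: (@le0_of_le_geometric _ (nrm2 h)) => n.
  have -> : normc (L2dot x h) = normc (L2dot (fun z => x_ n z - x z) h).
    by rewrite L2dotB// (Kx n).2// sub0r normcN.
  apply: le_trans (cauchy_schwarz (L2B (Lx n) Lx0) Lh) _.
  by rewrite mulrC ler_wpM2l ?nrm2_ge0.
exists x => // h Kh; have [Lh _] := Kh.
apply/eqP; rewrite -subr_eq0 -sqrf_eq0 eq_le sqr_ge0 andbT.
(* The factor 4 leaves room: the two estimates below add up to 5/2. *)
apply: (@le0_of_le_geometric _ (4 * nrm2 h)) => n.
(* Since [x_ n] is within [4^-n / 4] of the infimum, the increment of [J] along [h] plus that excess
   is a nonnegative quadratic in [s]. *)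
have a1 : (complex.Re (L2dot (x_ n) h) - l h) ^+ 2 <=
    nrm2 h * ((4^-1) ^+ n / 4).
  apply: discr_le; first exact: nrm2_ge0.
  move=> s; have := mJ _ (orthc_lin s%:C SL Kh (Kx n)); rewrite JE//.
  have := Jx n; move: (J _) (nrm2 h) ((4^-1) ^+ n) => a b c.
  move: (complex.Re _ - _) => e; lra.
have a2 := cauchy_schwarz_re (L2B (Lx n) Lx0) Lh.
have a3 : complex.Re (L2dot (fun z => x_ n z - x z) h) =
   complex.Re (L2dot (x_ n) h) - complex.Re (L2dot x h).
  by rewrite L2dotB//; case: (L2dot _ _) (L2dot _ _) => [? ?] [? ?].
rewrite a3 in a2.
have {}a2 : (complex.Re (L2dot (x_ n) h) - complex.Re (L2dot x h)) ^+ 2 <=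
   (4^-1) ^+ n * nrm2 h.
  by apply: le_trans a2 _; rewrite ler_wpM2r ?nrm2_ge0.
move: a1 a2 (nrm2_ge0 h); have : 0 <= ((4^-1) ^+ n : R) by rewrite exprn_ge0.
move: (complex.Re _) (complex.Re _) (l h) (nrm2 h) ((4^-1) ^+ n) => a b c N g.
move=> g0 a1 a2 N0.
have gN : 0 <= g * N by exact: mulr_ge0.
have : 0 <= ((b - c) + (b - a)) ^+ 2 by exact: sqr_ge0.
lra.
Qed.

Definition linear_on S (l : (C -> C) -> C) :=
  forall (c : C) f g, orthc S f -> orthc S g ->
    l (fun z => c * f z + g z) = c * l f + l g.

Definition bounded_on S (l : (C -> C) -> C) :=
  exists2 M : R, 0 <= M &
    forall f, orthc S f -> normc (l f) ^+ 2 <= M * nrm2 f.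

Lemma riesz S l : S `<=` L2 -> linear_on S l -> bounded_on S l ->
  exists2 x, orthc S x & forall h, orthc S h -> l h = L2dot h x.
Proof.
move=> SL lin [M M0 bnd].
have [||x Kx xP] := @riesz_real S (fun f => complex.Re (l f)) M SL M0.
- move=> a f g Kf Kg; rewrite lin//.
  by case: (l f) (l g) => [? ?] [? ?] /=; ring.
- move=> f Kf; apply: le_trans (bnd f Kf); rewrite normc2E.
  by rewrite lerDl sqr_ge0.
have [Lx _] := Kx.
exists x => // h Kh; have [Lh _] := Kh.
rewrite (L2dotC Lx Lh).
apply: complex_eqP; first by rewrite RecJ xP.
(* The imaginary part is recovered from the real part of the functional at [i h]. *)
have := xP _ (orthcZ (0 +i* 1) SL Kh).
rewrite L2dotZr//.
have -> : l (fun z => (0 +i* 1) * h z) = (0 +i* 1) * l h.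
  have l0 : l (fun=> 0) = 0.
    apply: eq0_normc; apply/eqP; rewrite -sqrf_eq0 eq_le sqr_ge0 andbT.
    apply: le_trans (bnd _ (orthc0 S)) _.
    have -> : nrm2 (fun=> 0) = 0 :> R.
      by apply: complexI; rewrite -L2dotff L2dot0.
    by rewrite mulr0.
  have := lin (0 +i* 1) h (fun=> 0) Kh (orthc0 S); rewrite l0 addr0 => <-.
  by congr l; apply/funext => z; rewrite addr0.
by rewrite ImcJ; case: (l h) (L2dot x h) => [a b] [c d] /=; lra.
Qed.

(** The projection is the Riesz representative of the pairing with [f], restricted to the
    subspace. *)
Lemma proj_exists S f : S `<=` L2 -> L2 f ->
  exists2 p, orthc S p & forall h, orthc S h -> L2dot h p = L2dot h f.
Proof.
move=> SL Lf; have [||p Kp pP] := @riesz S (fun h => L2dot h f) SL.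
- by move=> c g h [Lg _] [Lh _]; rewrite L2dot_lin.
- by exists (nrm2 f); [exact: nrm2_ge0|move=> h [Lh _]; rewrite mulrC; exact: cauchy_schwarz].
by exists p => // h Kh; rewrite -pP.
Qed.

End Riesz.

(** * Uniqueness of Fourier coefficients *)

Section Cutoff.
Context {R : realType}.

Lemma bernoulli_ge (s : R) m : -1 <= s -> 1 + m%:R * s <= (1 + s) ^+ m.
Proof.
move=> s1; elim: m => [|m IH]; first by rewrite mul0r addr0 expr0.
rewrite exprS; apply: (@le_trans _ _ ((1 + s) * (1 + m%:R * s))).
  rewrite -natr1 -subr_ge0 (_ : _ - _ = m%:R * s ^+ 2); last by ring.
  by rewrite mulr_ge0// sqr_ge0.
by rewrite ler_wpM2l// -[leLHS](subrr 1) -[X in _ <= X]opprK; lra.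
Qed.

(* [1 - x^n] raised to the power [2^n] is the classical polynomial
   approximation of the indicator of [x < 1/2]. *)
Lemma cutoff_cvg1 (x : R) : 0 <= x -> x < 2^-1 ->
  (1 - x ^+ n) ^+ (2 ^ n) @[n --> \oo] --> (1 : R).
Proof.
move=> x0 x2.
have lim1 : (1 - (2 * x) ^+ n) @[n --> \oo] --> (1 : R).
  rewrite -[X in _ --> X]subr0; apply: cvgB; first exact: cvg_cst.
  by apply: cvg_expr; rewrite ger0_norm ?mulr_ge0//; lra.
apply: (squeeze_cvgr _ lim1); [apply: nearW => n|exact: cvg_cst].
have xn1 : x ^+ n <= 1 by rewrite exprn_ile1//; lra.
have xn0 : 0 <= x ^+ n by exact: exprn_ge0.
apply/andP; split; last by apply: exprn_ile1; lra.
(* Bernoulli's inequality bounds the power below by [1 - (2 x)^n]. *)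
have := @bernoulli_ge (- x ^+ n) (2 ^ n); rewrite natrX exprMn mulrN.
by apply; lra.
Qed.

(** By Bernoulli [(1 + x^n)^(2^n) >= (2 x)^n], and the product of this power with the cutoff is
    [(1 - x^(2n))^(2^n) <= 1]; hence the cutoff is at most [(2 x)^(-n)]. *)
Lemma cutoff_cvg0 (x : R) : 2^-1 < x -> x <= 1 ->
  (1 - x ^+ n) ^+ (2 ^ n) @[n --> \oo] --> (0 : R).
Proof.
move=> x2 x1.
have x20 : 0 < 2 * x by lra.
have lim0 : ((2 * x)^-1 ^+ n) @[n --> \oo] --> (0 : R).
  apply: cvg_expr; rewrite ger0_norm ?invr_ge0 ?ltW// invf_lt1//; lra.
apply: (squeeze_cvgr _ (cvg_cst 0) lim0); apply: nearW => n.
have x0 : 0 <= x by lra.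
have xn1 : x ^+ n <= 1 by rewrite exprn_ile1.
have xn0 : 0 <= x ^+ n by exact: exprn_ge0.
have p0 : 0 <= (1 - x ^+ n) ^+ (2 ^ n) by rewrite exprn_ge0// subr_ge0.
rewrite p0/= exprVn -[leRHS]div1r ler_pdivlMr ?exprn_gt0//.
have := @bernoulli_ge (x ^+ n) (2 ^ n); rewrite natrX -exprMn => h.
apply: (@le_trans _ _ ((1 - x ^+ n) ^+ (2 ^ n) * (1 + x ^+ n) ^+ (2 ^ n))).
  by rewrite ler_wpM2l//; have := h ltac:(lra); lra.
rewrite -exprMn; apply: exprn_ile1.
  by rewrite mulr_ge0; lra.
rewrite (_ : _ * _ = 1 - (x ^+ n) ^+ 2); last by ring.
by rewrite lerBlDr lerDl sqr_ge0.
Qed.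

End Cutoff.

Section FourierUniqueness.
Context {R : realType}.
Local Notation C := R[i].
Local Notation mu := (@lebesgue_measure R).
Local Notation arc := (@Defs.arc R).

(** Asking for all coefficients of [f e] to vanish, not just the mean, makes the admissible factors
    [e] stable under multiplication by powers of [z], hence by polynomials in any [trig c0 a].
    Boundedness of [e] keeps [f e] integrable. *)
Definition annihilates (f e : C -> C) :=
  Linf e /\ forall n : int, cint (fun z => f z * e z * zpow n z) = 0.

Lemma annihilates_ext f e e' : (forall z, e z = e' z) ->
  annihilates f e -> annihilates f e'.
Proof. by move=> /funext ->. Qed.

Lemma annihilates_lin f e e' (c : C) : cintegrable f -> annihilates f e ->
  annihilates f e' -> annihilates f (fun z => c * e z + e' z).
Proof.
move=> If [be he] [be' he']; split.
  by apply: LinfD => //; apply: LinfM => //; exact: Linf_cst.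
move=> n.
have I1 : cintegrable (fun z => f z * e z * zpow n z).
  apply: CI_ext (CI_bmul (LinfM be (Linf_zpow n)) If) => z _; ring.
have I2 : cintegrable (fun z => f z * e' z * zpow n z).
  apply: CI_ext (CI_bmul (LinfM be' (Linf_zpow n)) If) => z _; ring.
rewrite (@cint_ext _ _ (fun z => c * (f z * e z * zpow n z) + f z * e' z * zpow n z)).
  by rewrite cintD ?cintZ ?he ?he' ?mulr0 ?addr0//; exact: CIZ.
by move=> z _; ring.
Qed.

Lemma annihilates_zpow f e (m : int) : annihilates f e ->
  annihilates f (fun z => zpow m z * e z).
Proof.
move=> [be he]; split; first exact: LinfM (Linf_zpow m) be.
move=> n; rewrite -(he (m + n)); apply: cint_ext => z oz.
by rewrite zpowD//; ring.
Qed.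

Definition trig (c0 a : C) (z : C) := c0 + a * zpow 1 z + a^* * zpow (-1) z.

Lemma annihilates_trig f e c0 a : cintegrable f -> annihilates f e ->
  annihilates f (fun z => trig c0 a z * e z).
Proof.
move=> If he.
have h1 := annihilates_zpow 1 he; have h2 := annihilates_zpow (-1) he.
(* [annihilates_lin] only yields [c * e + e'], so the term [c0 * e] is assembled as
   [(c0 - 1) * e + e]. *)
have h0 : annihilates f (fun z => 0 * e z + (c0 - 1) * e z).
  have ee := annihilates_lin (-1) If he he.
  have := annihilates_lin (c0 - 1) If he ee.
  by apply: annihilates_ext => z; ring.
have := annihilates_lin a If h1 (annihilates_lin (a^*) If h2
  (annihilates_lin 1 If h0 he)).
by apply: annihilates_ext => z; rewrite /trig; ring.
Qed.

Lemma annihilates_cutoff f c0 a j m : cintegrable f ->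
  annihilates f (fun=> 1) ->
  annihilates f (fun z => (1 - trig c0 a z ^+ j) ^+ m).
Proof.
move=> If h1.
have hX i e : annihilates f e -> annihilates f (fun z => trig c0 a z ^+ i * e z).
  move=> he; elim: i => [|i IH].
    by apply: annihilates_ext he => z; rewrite expr0 mul1r.
  by apply: annihilates_ext (annihilates_trig c0 a If IH) => z; rewrite exprS mulrA.
elim: m => [|m IH].
  by apply: annihilates_ext h1 => z; rewrite expr0.
apply: annihilates_ext (annihilates_lin (-1) If (hX j _ IH) IH) => z.
by rewrite exprS; ring.
Qed.

Lemma sin_mulpi_gt0 (s : R) : 0 < s -> s < 1 -> 0 < sin (pi * s).
Proof.
move=> s0 s1; apply: sin_gt0_pi.
by rewrite mulr_gt0 ?pi_gt0//= -[ltRHS]mulr1 ltr_pM2l ?pi_gt0.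
Qed.

(** A trigonometric polynomial of degree one in [t], centred at [y / 2], that separates []0, y[]
    from []y, 1[] at height 1/2. The factor 1/4 keeps its values in [[0, 1]], as the cutoff
    requires. *)
Let X (y t : R) := 2^-1 + (cos (2 * pi * (t - y / 2)) - cos (pi * y)) / 4.

Lemma bump_trig (y t : R) :
  trig (2^-1 - cos (pi * y) / 4)%:C ((8^-1)%:C * (circ (y / 2))^*) (circ t) =
  (X y t)%:C.
Proof.
rewrite /trig cJM cJr cJK zpow1 -(zpowJ 1 (onc_circ t)) zpow1 /circ /X.
rewrite mulrBr cosB; apply: complex_eqP;
  by rewrite !(RecD, ImcD, RecM, ImcM, RecJ, ImcJ)/=; field.
Qed.

Lemma bump_ge0 y t : 0 <= X y t.
Proof.
rewrite /X; have := cos_geN1 (2 * pi * (t - y / 2)); have := cos_le1 (pi * y).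
by lra.
Qed.

Lemma bump_le1 y t : X y t <= 1.
Proof.
rewrite /X; have := cos_le1 (2 * pi * (t - y / 2)); have := cos_geN1 (pi * y).
by lra.
Qed.

(** The product form exhibits the sign of the deviation from 1/2 on either side of [y]. *)
Lemma bumpE y t : X y t = 2^-1 + sin (pi * t) * sin (pi * (y - t)) / 2.
Proof.
rewrite /X.
have -> : 2 * pi * (t - y / 2) = pi * t - pi * (y - t) by field.
have -> : pi * y = pi * t + pi * (y - t) by ring.
by rewrite cosB cosD; field.
Qed.

Lemma bump_gt y t : 0 < t -> t < y -> y < 1 -> 2^-1 < X y t.
Proof.
move=> t0 ty y1; rewrite bumpE ltrDl divr_gt0// mulr_gt0//; apply: sin_mulpi_gt0;
  lra.
Qed.

Lemma bump_lt y t : 0 < y -> y < t -> t < 1 -> X y t < 2^-1.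
Proof.
move=> y0 yt t1; rewrite bumpE gtrDl -opprB mulrN sinN mulrN mulNr oppr_lt0.
rewrite divr_gt0// mulr_gt0//; apply: sin_mulpi_gt0; lra.
Qed.

Lemma int_cutoff (f : C -> C) : cintegrable f ->
  annihilates f (fun z => 1) -> forall y n,
  \int[mu]_(t in arc) (complex.Re (f (circ t)) * (1 - X y t ^+ n) ^+ (2 ^ n)) = 0 /\
  \int[mu]_(t in arc) (complex.Im (f (circ t)) * (1 - X y t ^+ n) ^+ (2 ^ n)) = 0.
Proof.
move=> If h1 y n.
have [_ /(_ 0)] := annihilates_cutoff (2^-1 - cos (pi * y) / 4)%:C
  ((8^-1)%:C * (circ (y / 2))^*) n (2 ^ n) If h1.
set p := (fun z => _) => p0.
have pE t : p (circ t) = f (circ t) * ((1 - X y t ^+ n) ^+ (2 ^ n))%:C.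
  by rewrite /p bump_trig zpow0 mulr1 !rmorphXn rmorphB rmorph1 rmorphXn.
move: p0; rewrite /cint => -[hr hi]; split.
  rewrite -[RHS]hr; apply: rint_ext => t _; rewrite pE RecM /=; ring.
rewrite -[RHS]hi; apply: rint_ext => t _; rewrite pE ImcM /=; ring.
Qed.

(** Dominated convergence: the cutoffs lie between 0 and 1 and tend to the indicator of []y, 1[],
    except perhaps at 0 and [y], where [X y] equals 1/2. *)
Lemma tail_int0 (u : R -> R) (y : R) : rintegrable u -> 0 < y -> y < 1 ->
  (forall n, \int[mu]_(t in arc) (u t * (1 - X y t ^+ n) ^+ (2 ^ n)) = 0) ->
  rintegrable (fun t => if t <= y then 0 else u t) /\
  \int[mu]_(t in arc) (if t <= y then 0 else u t) = 0.
Proof.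
move=> Iu y0 y1 h.
pose v t := if t <= y then 0 else u t.
have mX : measurable_fun arc (X y).
  rewrite /X; apply: measurable_funTS; apply: continuous_measurable_fun => t.
  apply: cvgD; first exact: cvg_cst.
  apply: cvgM; last exact: cvg_cst.
  apply: cvgB; last exact: cvg_cst.
  apply: (@continuous_comp _ _ _ (fun t => 2 * pi * (t - y / 2)) cos).
    apply: cvgM; first exact: cvg_cst.
    apply: cvgB; [exact: cvg_id|exact: cvg_cst].
  exact: continuous_cos.
have mv : measurable_fun arc v.
  apply: measurable_fun_if.
  - exact: measurable_itv.
  - by apply: measurable_fun_ler; [exact: measurable_id|exact: measurable_cst].
  - exact: measurable_cst.
  - apply: (measurable_funS _ _ (rI_meas Iu)); [exact: measurable_itv|exact: subIsetl].
have mf n : measurable_fun arc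
    (fun t => (u t * (1 - X y t ^+ n) ^+ (2 ^ n))%:E).
  apply/measurable_EFinP; apply: measurable_funM; first exact: rI_meas.
  apply: measurable_funX; apply: measurable_funB; first exact: measurable_cst.
  exact: measurable_funX.
have cv : {ae mu, forall t, arc t ->
   (u t * (1 - X y t ^+ n) ^+ (2 ^ n))%:E @[n --> \oo] --> (v t)%:E}.
  exists ([set 0] `|` [set y]); split.
  - by apply: measurableU; exact: measurable_set1.
  - by apply: countable_lebesgue_measure0; apply: finite_set_countable;
      rewrite finite_setU; split; exact: finite_set1.
  - move=> t /= nt; apply: contrapT => /not_orP [/eqP t0 /eqP ty]; apply: nt.
    rewrite /Defs.arc /= in_itv/= => /andP [t0' t1].
    apply: cvg_EFin; first exact: nearW.
    rewrite /comp /= /v; case: ifPn => [ty'|]; last rewrite -ltNge => ty'.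
      rewrite -(mulr0 (u t)); apply: cvgM; first exact: cvg_cst.
      apply: cutoff_cvg0; last exact: bump_le1.
      by apply: bump_gt => //; rewrite lt_def ?t0 ?t0'// ty' eq_sym ty.
    rewrite -[X in _ --> X](mulr1 (u t)); apply: cvgM; first exact: cvg_cst.
    apply: cutoff_cvg1; first exact: bump_ge0.
    exact: bump_lt.
have Iabs : mu.-integrable arc (fun t => `|u t|%:E) by exact: integrable_norm.
have mv' : measurable_fun arc (fun t => (v t)%:E) by exact/measurable_EFinP.
have dom : {ae mu, forall t, forall n, arc t ->
    (`|(u t * (1 - X y t ^+ n) ^+ (2 ^ n))%:E| <= `|u t|%:E)%E}.
  apply: aeW => t n _; rewrite /= lee_fin normrM -[leRHS]mulr1 ler_wpM2l//.
  have xn1 : X y t ^+ n <= 1 by rewrite exprn_ile1 ?bump_ge0 ?bump_le1.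
  have xn0 : 0 <= X y t ^+ n by rewrite exprn_ge0 ?bump_ge0.
  have a : 0 <= 1 - X y t ^+ n by lra.
  rewrite ger0_norm; last exact: exprn_ge0.
  by apply: exprn_ile1 => //; lra.
have [Iv _ lim] := dominated_convergence measurable_arc mf mv' cv Iabs dom.
split => //.
move: lim; have -> : [sequence (\int[mu]_(t in arc)
    (u t * (1 - X y t ^+ n) ^+ (2 ^ n))%:E)%E]_n = (fun=> 0%E).
  apply/funext => n /=.
  have In : rintegrable (fun t => u t * (1 - X y t ^+ n) ^+ (2 ^ n)).
    apply: (rI_dom (v := fun t => `|u t|)) => //.
      by apply/measurable_EFinP; exact: mf.
    move=> t _; rewrite normrM -[leRHS]mulr1 ler_wpM2l//.
    have xn1 : X y t ^+ n <= 1 by rewrite exprn_ile1 ?bump_ge0 ?bump_le1.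
    have xn0 : 0 <= X y t ^+ n by rewrite exprn_ge0 ?bump_ge0.
    have a : 0 <= 1 - X y t ^+ n by lra.
    rewrite ger0_norm; last exact: exprn_ge0.
    by apply: exprn_ile1 => //; lra.
  by rewrite -(fineK (integrable_fin_num measurable_arc In)); congr EFin; exact: h.
move=> lim; have e : (0 = \int[mu]_(t in arc) (v t)%:E)%E.
  exact: (cvg_unique (@ereal_hausdorff R) (cvg_cst 0%E) lim).
by rewrite /Rintegral -e.
Qed.

(* By Lebesgue's differentiation theorem. *)
Lemma ae_eq0_of_tails (u : R -> R) : rintegrable u ->
  \int[mu]_(t in arc) u t = 0 ->
  (forall y, 0 < y -> y < 1 ->
    rintegrable (fun t => if t <= y then 0 else u t) /\
    \int[mu]_(t in arc) (if t <= y then 0 else u t) = 0) ->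
  ae_eq mu arc u (cst 0).
Proof.
move=> Iu u0 tails.
pose w := u \_ arc.
have loc : locally_integrable [set: R] w by exact: integrable_locally.
have Iw : mu.-integrable setT (EFin \o w).
  rewrite /w -restrict_EFin; apply/(integrable_mkcond _ _).1 => //.
have Iwy y : mu.-integrable [set` `]-oo, y]] (EFin \o w).
  by apply: (integrableS measurableT) => //; exact: measurable_itv.
have F0 y : \int[mu]_(t in [set` `]-oo, y]]) w t = 0.
  rewrite /w Rintegral_mkcond -patch_setI setIC.
  rewrite -Rintegral_mkcond.
  have [y1|y1] := leP 1 y.
    rewrite (_ : _ `&` _ = arc)//; apply/seteqP; split => t /=; first by case.
    rewrite /Defs.arc/= !in_itv/= => /andP [a b]; split => //; first by rewrite a.
    by rewrite (le_trans (ltW b)).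
  have [y0|y0] := ltP y 0.
    rewrite (_ : _ `&` _ = set0) ?Rintegral_set0//; apply/seteqP; split => t //=.
    rewrite /Defs.arc/= !in_itv/= => -[/andP [a b] c].
    by have := le_lt_trans (le_trans a c) y0; rewrite ltxx.
  have [yeq0|yn0] := eqVneq y 0.
    rewrite (_ : _ `&` _ = [set 0]) ?Rintegral_set1//; apply/seteqP; split => t /=.
      rewrite /Defs.arc/= !in_itv/= yeq0 => -[/andP [a b] c].
      by apply/eqP; rewrite eq_le a c.
    by move=> ->; rewrite /Defs.arc/= !in_itv/= lexx ltr01 yeq0.
  have yp : 0 < y by rewrite lt_def yn0.
  have [Iv v0] := tails y yp y1.
  (* Over [[0, y]] the integral is the one over [arc] minus the tail, and both vanish. *)
  rewrite -[RHS]subr0 -[X in X - _]u0 -[X in _ - X]v0 -RintegralB//.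
  rewrite Rintegral_mkcondr; apply: rint_ext => t at_.
  rewrite /patch mem_setE in_itv/=; case: (leP t y) => _; first by rewrite subr0.
  by rewrite subrr.
have := FTC1Ny Iwy loc.
have -> : (fun x => \int[mu]_(t in [set` `]-oo, x]]) w t) = cst 0.
  by apply/funext => y; rewrite F0.
move=> ftc; apply: (aeS ftc) => t [_] + at_.
rewrite derive1_cst => w0.
by rewrite /= w0 /w patchT// mem_set.
Qed.

(** Vanishing coefficients pass to the cutoffs and so to the integrals over all []y, 1[], which
    determine the function. It is stated for integrable [f] because [coprime_divides] applies it to
    a squared modulus. *)
Theorem fourier_unique (f : C -> C) : cintegrable f ->
  (forall n : int, cint (fun z => f z * zpow n z) = 0) -> aeq f (fun=> 0).
Proof.
move=> If f0; have [Ir Ii] := If.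
have h1 : annihilates f (fun=> 1).
  split; first exact: Linf_cst.
  by move=> n; rewrite -(f0 n); apply: cint_ext => z _; rewrite mulr1.
have cutoff := int_cutoff If h1.
have f00 : cint f = 0.
  by rewrite -(f0 0); apply: cint_ext => z _; rewrite zpow0 mulr1.
have [r0 i0] : \int[mu]_(t in arc) complex.Re (f (circ t)) = 0 /\
    \int[mu]_(t in arc) complex.Im (f (circ t)) = 0 by case: f00.
have hr := ae_eq0_of_tails Ir r0 (fun y y0 y1 =>
  tail_int0 Ir y0 y1 (fun n => (cutoff y n).1)).
have hi := ae_eq0_of_tails Ii i0 (fun y y0 y1 =>
  tail_int0 Ii y0 y1 (fun n => (cutoff y n).2)).
apply: (aeS2 hr hi) => t a b at_.
by apply: complex_eqP; [exact: a|exact: b].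
Qed.

End FourierUniqueness.

(** * The power map on the circle *)

Section PowerMap.
Context {R : realType}.
Local Notation C := R[i].
Local Notation mu := (@lebesgue_measure R).
Local Notation arc := (@Defs.arc R).

Lemma Rint_arc_FTC (F f : R -> R) : (forall t, is_derive t (1 : R) F (f t)) ->
  continuous f -> rintegrable f -> \int[mu]_(t in arc) f t = F 1 - F 0.
Proof.
move=> dF cf If; rewrite Rintegral_itv_bndo_bndc//.
have cF : continuous F.
  by move=> t; apply/differentiable_continuous/derivable1_diffP; case: (dF t).
rewrite /Rintegral (@continuous_FTC2 _ f F)//.
- exact: continuous_subspaceT.
- split; first by move=> t _; case: (dF t).
    by apply: cvg_at_right_filter; exact: cF.
  by apply: cvg_at_left_filter; exact: cF.
- by move=> t _; rewrite derive1E; apply: derive_val.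
Qed.

Lemma cint_zpow (n : int) : cint (zpow n : C -> C) = (n == 0)%:R.
Proof.
have [->|n0] := eqVneq n 0.
  rewrite /cint; apply: complex_eqP => /=.
    have m1 : fine (mu arc) = 1 by rewrite mu_arc.
    rewrite Rintegral_cst; last exact: measurable_itv.
    by rewrite [X in _ * X]m1 mulr1.
  rewrite Rintegral_cst; last exact: measurable_itv.
  by rewrite mul0r.
pose a : R := 2 * pi * n%:~R.
have a0 : a != 0.
  by rewrite !mulf_neq0 ?intr_eq0// gt_eqF// pi_gt0.
have [Ir Ii] := L2_CI (L2_zpow (R := R) n).
have e1 : cos a = 1 /\ sin a = 0.
  by have := circ_int (R := R) n; rewrite /circ -/a => -[-> ->].
have zr t : complex.Re (zpow n (circ t)) = cos (a * t).
  by rewrite zpow_circ /= /a mulrA.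
have zi t : complex.Im (zpow n (circ t)) = sin (a * t).
  by rewrite zpow_circ /= /a mulrA.
rewrite /cint; apply: complex_eqP => /=.
  have d t : is_derive t (1 : R) (fun t => a^-1 * sin (a * t))
      (complex.Re (zpow n (circ t))).
    rewrite zr; apply: is_derive_eq.
    by rewrite -[LHS]/(a^-1 * (cos (a * t) * (a * 1))) mulr1 mulrC -mulrA mulfV// mulr1.
  rewrite (Rint_arc_FTC d) ?mulr1 ?mulr0 ?sin0 ?e1.2 ?mulr0 ?subrr//.
  under eq_fun do rewrite zr.
  by apply: continuous_lin_comp; exact: continuous_cos.
have d t : is_derive t (1 : R) (fun t => - a^-1 * cos (a * t))
    (complex.Im (zpow n (circ t))).
  rewrite zi; apply: is_derive_eq.
  rewrite -[LHS]/(- a^-1 * (- sin (a * t) * (a * 1))).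
  by rewrite mulr1 !mulNr mulrN opprK mulrC -mulrA mulfV// mulr1.
rewrite (Rint_arc_FTC d) ?mulr1 ?mulr0 ?cos0 ?e1.1 ?subrr//.
under eq_fun do rewrite zi.
by apply: continuous_lin_comp; exact: continuous_sin.
Qed.

Lemma L2dot_zpow (m n : int) : L2dot (zpow m) (zpow n : C -> C) = (m == n)%:R.
Proof.
rewrite -subr_eq0 -cint_zpow; apply: cint_ext => z oz.
by rewrite zpowJ// zpowD.
Qed.

Definition affine (a b t : R) : measurableTypeR R := a * t + b.

Lemma measurable_affine (a b : R) :
  measurable_fun [set: measurableTypeR R] (affine a b).
Proof.
apply: continuous_measurable_fun => t.
by apply: cvgD; [apply: cvgM; [exact: cvg_cst|exact: cvg_id]|exact: cvg_cst].
Qed.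

(** Lebesgue measure is determined by its values on the intervals []c, d]], where scaling is a
    direct computation. *)
Lemma lebesgue_measure_affine (a b : R) (a0 : 0 < a) (A : set (measurableTypeR R)) :
  measurable A -> mu A = pushforward (mscale (NngNum (ltW a0)) mu) (affine a b) A.
Proof.
move=> mA; apply: lebesgue_measure_unique mA => //=.
  exact: measurable_affine.
move=> _ _ [[c d] _ <-]; rewrite /pushforward /mscale /=.
have -> : affine a b @^-1` `]c, d] = `](c - b) / a, (d - b) / a]%classic.
  apply/seteqP; split => t /=; rewrite /affine !in_itv/= ltr_pdivrMr// ler_pdivlMr//;
    by rewrite ltrBlDr lerBrDr mulrC.
rewrite !lebesgue_measure_itv/= !lte_fin ltr_pM2r ?invr_gt0// ltrD2r.
case: ifP => _; last by rewrite mule0.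
by rewrite -!EFinB -EFinM; congr EFin; field; rewrite gt_eqF.
Qed.

Lemma ge0_integral_affine (a b : R) (D : set (measurableTypeR R)) (F : R -> \bar R) :
  0 < a -> measurable D -> measurable_fun D F -> (forall t, D t -> 0 <= F t)%E ->
  (\int[mu]_(t in D) F t = a%:E * \int[mu]_(t in affine a b @^-1` D) F (affine a b t))%E.
Proof.
move=> a0 mD mF F0.
have mphi := measurable_affine a b.
have mpD : measurable (affine a b @^-1` D).
  by rewrite -[X in measurable X]setTI; exact: mphi.
rewrite (eq_measure_integral (pushforward (mscale (NngNum (ltW a0)) mu) (affine a b))); last first.
  by move=> A mA _; exact: lebesgue_measure_affine.
rewrite ge0_integral_pushforward//; last by move=> t; rewrite inE; exact: F0.
rewrite ge0_integral_mscale//.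
  by apply: (measurable_comp mD) => //;
    [move=> _ [t Dt <-]|exact: measurable_funTS].
by move=> t /F0.
Qed.

Section Pieces.
Variable k : nat.
Hypothesis k0 : (0 < k)%N.

Let kR : (0 : R) < k%:R.
Proof. by rewrite ltr0n. Qed.

(** The piece [[j/k, (j+1)/k[], on which [z^k] is read as the affine bijection [t -> k t - j] onto
    [arc]; the pieces with [j < k] partition [arc]. *)
Let I (j : nat) : set (measurableTypeR R) := affine k%:R (- j%:R) @^-1` arc.

Let mI j : measurable (I j).
Proof. by rewrite -[X in measurable X]setTI; exact: measurable_affine. Qed.

Let IP j t : I j t <-> j%:R <= k%:R * t < j.+1%:R.
Proof.
rewrite /I /Defs.arc /= in_itv/= /affine subr_ge0 ltrBlDr -natr1.
by rewrite [1 + _]addrC.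
Qed.

Let circ_affine j t : circ t ^+ k = circ (affine k%:R (- j%:R) t).
Proof.
rewrite circX /affine circD.
have -> : - j%:R = (- j%:Z)%:~R :> R by rewrite rmorphN.
by rewrite circ_int mulr1.
Qed.

Let arcE : arc = \big[setU/set0]_(j <- iota 0 k) I j.
Proof.
rewrite -bigcup_seq; apply/seteqP; split => t.
  rewrite /Defs.arc/= in_itv/= => /andP [t0 t1].
  have kt0 : 0 <= k%:R * t by rewrite mulr_ge0// ltW.
  exists (Num.truncn (k%:R * t)).
    rewrite /= mem_iota/= add0n -(ltr_nat R).
    have /andP [h _] := truncn_itv kt0.
    by apply: le_lt_trans h _; rewrite -[ltRHS]mulr1 ltr_pM2l.
  by apply/IP; exact: truncn_itv.
move=> [j /=]; rewrite mem_iota/= add0n => jk /IP /andP [a b].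
rewrite /Defs.arc/= in_itv/=; apply/andP; split.
  by rewrite -(pmulr_rge0 _ kR) (le_trans _ a)// ler0n.
rewrite -(ltr_pM2l kR) mulr1; apply: lt_le_trans b _.
by rewrite ler_nat.
Qed.

Let triv : trivIset [set` iota 0 k] I.
Proof.
apply/trivIsetP => i j _ _ ij; apply/seteqP; split => t //= -[/IP a /IP b].
have key (p q : nat) : (p < q)%N -> k%:R * t < p.+1%:R -> q%:R <= k%:R * t -> False.
  move=> pq h1 h2; have := le_lt_trans h2 h1.
  by rewrite ltr_nat ltnS leqNgt pq.
move/andP : a => [a1 a2]; move/andP : b => [b1 b2].
by move: ij; rewrite neq_ltn => /orP [/key|/key]; apply.
Qed.

Lemma measurable_power d (T : sigmaRingType d) (F : C -> T) :
  measurable_fun arc (fun t => F (circ t)) ->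
  measurable_fun arc (fun t => F (circ t ^+ k)).
Proof.
move=> mF.
have mFI j : measurable_fun (I j) (fun t => F (circ t ^+ k)).
  under eq_fun do rewrite (circ_affine j).
  apply: (measurable_comp measurable_arc) (mF) _ => //.
    by move=> _ [t Dt <-].
  by apply: measurable_funTS; exact: measurable_affine.
apply: (@measurable_funS _ _ _ _ (\bigcup_j I j)).
- exact: bigcupT_measurable.
- by rewrite {1}arcE -bigcup_seq => t [j _ Ij]; exists j.
- by apply/measurable_fun_bigcup => // j; exact: mFI.
Qed.

(** The circle measure is invariant under the power map: each of the [k] pieces contributes [1/k] of
    the integral. *)
Lemma ge0_integral_power (F : C -> \bar R) :
  measurable_fun arc (fun t => F (circ t)) -> (forall z, 0 <= F z)%E ->
  (\int[mu]_(t in arc) F (circ t ^+ k)%R = \int[mu]_(t in arc) F (circ t))%E.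
Proof.
move=> mF F0; have mF' := measurable_power mF.
rewrite {1}arcE ge0_integral_bigsetU//; last 2 first.
- exact: iota_uniq.
- by rewrite -arcE.
have step j : (\int[mu]_(t in I j) F (circ t ^+ k)%R =
    (k%:R^-1)%:E * \int[mu]_(t in arc) F (circ t))%E.
  rewrite (ge0_integral_affine (- j%:R) kR measurable_arc mF)//.
  rewrite muleA -EFinM mulVf ?gt_eqF// mul1e.
  by apply: eq_integral => t _; rewrite (circ_affine j).
rewrite (eq_bigr (fun=> (k%:R^-1)%:E * \int[mu]_(t in arc) F (circ t))%E); last first.
  by move=> j _; exact: step.
rewrite -ge0_sume_distrl; last by move=> j _; rewrite lee_fin invr_ge0.
rewrite sumEFin big_const_seq count_predT size_iota iter_addr_0.
by rewrite -[_^-1 *+ k]mulr_natl mulfV ?gt_eqF// mul1e.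
Qed.

End Pieces.

Lemma Wadj_cmeas k (f : C -> C) : (0 < k)%N -> cmeasurable f -> cmeasurable (Wadj k f).
Proof.
move=> k0 [a b]; split.
  exact: (measurable_power k0 (F := fun z => complex.Re (f z))).
exact: (measurable_power k0 (F := fun z => complex.Im (f z))).
Qed.

Lemma Wadj_isometry k (f : C -> C) : (0 < k)%N -> L2 f ->
  L2 (Wadj k f) /\ nrm2 (Wadj k f) = nrm2 f.
Proof.
move=> k0 [mf If].
have e : (\int[mu]_(t in arc) (normc (f (circ t ^+ k)) ^+ 2)%:E =
    \int[mu]_(t in arc) (normc (f (circ t)) ^+ 2)%:E)%E.
  apply: (ge0_integral_power k0 (F := fun z => (normc (f z) ^+ 2)%:E)).
    by apply/measurable_EFinP; exact: cmeas_norm2.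
  by move=> z; rewrite lee_fin sqr_ge0.
split; last by rewrite /nrm2 /Rintegral e.
have mk := Wadj_cmeas k0 mf.
split => //; apply/integrableP; split.
  by apply/measurable_EFinP; exact: cmeas_norm2.
under eq_integral do rewrite gee0_abs ?lee_fin ?sqr_ge0//.
rewrite e; move/integrableP : If => [_].
by under eq_integral do rewrite gee0_abs ?lee_fin ?sqr_ge0//.
Qed.

End PowerMap.

(** * The operator W_k *)

Section FourierCoefficients.
Context {R : realType}.
Local Notation C := R[i].
Implicit Types (f g h : C -> C).

Lemma L2_fourier_eq f g : L2 f -> L2 g ->
  (forall n : int, L2dot f (zpow n) = L2dot g (zpow n)) -> aeq f g.
Proof.
move=> Lf Lg fg; have Ld := L2B Lf Lg.
have := @fourier_unique _ (fun z => f z - g z) (L2_CI Ld).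
move=> h; apply: (aeq_mono (h _)) => [n|z _ /eqP]; last first.
  by rewrite subr_eq0 => /eqP.
transitivity (L2dot (fun z => f z - g z) (zpow (- n))).
  by apply: cint_ext => z oz; rewrite zpowJ// opprK.
rewrite L2dotB ?fg ?subrr//; exact: L2_zpow.
Qed.

Lemma aeq_dotr_eq f g : L2 f -> L2 g ->
  (forall h, L2 h -> L2dot h f = L2dot h g) -> aeq f g.
Proof.
move=> Lf Lg fg; apply: aeq_dot_eq => // h Lh.
by rewrite (L2dotC Lh Lf) (L2dotC Lh Lg) fg.
Qed.

Lemma orthc_set0 f : orthc set0 f <-> L2 f.
Proof. by split => [[]//|Lf]; split. Qed.

(** This stands in for the density of trigonometric polynomials: the two Riesz representatives have
    the same Fourier coefficients. The complement of [set0] is all of L^2. *)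
Lemma functional_eq (l1 l2 : (C -> C) -> C) :
  linear_on set0 l1 -> bounded_on set0 l1 ->
  linear_on set0 l2 -> bounded_on set0 l2 ->
  (forall n : int, l1 (zpow n) = l2 (zpow n)) ->
  forall h, L2 h -> l1 h = l2 h.
Proof.
move=> lin1 b1 lin2 b2 l12 h Lh.
have s0 : set0 `<=` (L2 : set (C -> C)) by [].
have [x1 /orthc_set0 Lx1 h1] := riesz s0 lin1 b1.
have [x2 /orthc_set0 Lx2 h2] := riesz s0 lin2 b2.
rewrite h1 ?h2; try exact/orthc_set0.
apply: L2dot_aeq => //; first exact: aeq_refl.
apply: L2_fourier_eq => // n; have Lz := @L2_zpow R n.
rewrite (L2dotC Lz Lx1) (L2dotC Lz Lx2) -h1 -?h2 ?l12//; exact/orthc_set0.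
Qed.

Lemma bounded_linear_nrm2 (K L : set (C -> C)) U : bounded_linear K L U ->
  exists2 M : R, 0 <= M & forall f, K f -> nrm2 (U f) <= M * nrm2 f.
Proof.
move=> [_ _ _ [M UM]]; exists (M ^+ 2); first exact: sqr_ge0.
move=> f Kf; have := UM f Kf; rewrite !L2normE => h.
rewrite -(sqr_sqrtr (nrm2_ge0 (U f))) -(sqr_sqrtr (nrm2_ge0 f)) -exprMn.
by rewrite ler_sqr ?nnegrE ?sqrtr_ge0// (le_trans _ h)// sqrtr_ge0.
Qed.

Lemma bounded_linear_functional (S L : set (C -> C)) U h :
  L `<=` L2 -> S `<=` L2 -> L2 h -> bounded_linear (orthc S) L U ->
  linear_on S (fun f => L2dot (U f) h) /\ bounded_on S (fun f => L2dot (U f) h).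
Proof.
move=> LL SL Lh bU; have [UL _ Ulin _] := bU; split.
  move=> c f g Kf Kg; have L1 := LL _ (UL _ Kf); have L2' := LL _ (UL _ Kg).
  rewrite -L2dot_lin//; apply: L2dot_aeq => //.
  - by apply/LL/UL; exact: orthc_lin.
  - exact: L2_lin.
  - exact: Ulin.
  - exact: aeq_refl.
have [M M0 UM] := bounded_linear_nrm2 bU.
exists (M * nrm2 h); first by rewrite mulr_ge0// nrm2_ge0.
move=> f Kf; apply: le_trans (cauchy_schwarz (LL _ (UL _ Kf)) Lh) _.
by rewrite mulrAC ler_wpM2r ?nrm2_ge0// UM.
Qed.

Lemma L2dot_functional (S : set (C -> C)) h : L2 h ->
  linear_on S (fun f => L2dot f h) /\ bounded_on S (fun f => L2dot f h).
Proof.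
move=> Lh; split; first by move=> c f g [Lf _] [Lg _]; rewrite L2dot_lin.
exists (nrm2 h); first exact: nrm2_ge0.
by move=> f [Lf _]; rewrite mulrC; exact: cauchy_schwarz.
Qed.

End FourierCoefficients.

Section Woperator.
Context {R : realType}.
Local Notation C := R[i].
Implicit Types (f g h : C -> C).
Variable k : nat.
Hypothesis k0 : (0 < k)%N.

Lemma Wadj_L2 f : L2 f -> L2 (Wadj k f).
Proof. by move=> /(Wadj_isometry k0) []. Qed.

Lemma Wadj_zpow n z : on_circle z -> Wadj k (zpow n) z = zpow (k%:Z * n) z :> C.
Proof. by move=> [t ->]; rewrite /Wadj /zpow exprnP exprz_exp. Qed.

Lemma Wadj_functional f : L2 f ->
  linear_on set0 (fun h => L2dot (Wadj k h) f) /\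
  bounded_on set0 (fun h => L2dot (Wadj k h) f).
Proof.
move=> Lf; split.
  by move=> c g h [Lg _] [Lh _]; rewrite -L2dot_lin//; exact: Wadj_L2.
exists (nrm2 f); first exact: nrm2_ge0.
move=> h [Lh _]; have [Lw <-] := Wadj_isometry k0 Lh.
by rewrite mulrC; exact: cauchy_schwarz.
Qed.

Let Wz (n : int) : C -> C :=
  if (k%:Z %| n)%Z then zpow (n %/ k%:Z)%Z else fun=> 0.

Lemma Wz_L2 n : L2 (Wz n).
Proof. by rewrite /Wz; case: ifP => _; [exact: L2_zpow|exact: L2_cst]. Qed.

(** It is enough to test [h = z^m], where both sides are 1 or 0 according to whether [k m = n]. *)
Lemma Wadj_dot_zpow n h : L2 h -> L2dot (Wadj k h) (zpow n) = L2dot h (Wz n).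
Proof.
have [la ba] := Wadj_functional (L2_zpow (R := R) n).
have [lb bb] := L2dot_functional set0 (Wz_L2 n).
apply: (functional_eq la ba lb bb) => m.
have -> : L2dot (Wadj k (zpow m)) (zpow n : C -> C) = (k%:Z * m == n)%:R.
  rewrite -L2dot_zpow; apply: L2dot_ext => z oz; congr (_ * _).
  exact: Wadj_zpow.
have kz : k%:Z != 0 by rewrite eqz_nat -lt0n.
rewrite /Wz; case: ifPn => kn.
  rewrite L2dot_zpow; congr (_%:R); congr nat_of_bool.
  by rewrite -{1}(divzK kn) mulrC (inj_eq (mulIf kz)).
rewrite (L2dotC (L2_cst 0) (L2_zpow m)) L2dot0 cJ0.
case: eqP => // e; move: kn; rewrite -e dvdz_mulr ?dvdzz//.
Qed.

(** The operator is built as the adjoint of the isometry [Wadj k], with a Riesz representative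
    chosen for each [f]; outside L^2 its value is arbitrary. *)
Lemma Wop_exists : exists W : (C -> C) -> C -> C, is_Wop k W.
Proof.
have /choice [W WP] : forall f, exists w : C -> C, L2 f ->
    L2 w /\ forall h, L2 h -> L2dot (Wadj k h) f = L2dot h w.
  move=> f; have [Lf|nLf] := pselect (L2 f); last by exists f.
  have [lin b] := Wadj_functional Lf.
  have [//|w /orthc_set0 Lw h] := riesz _ lin b.
  by exists w => _; split => // g Lg; apply: h; exact/orthc_set0.
have WL f : L2 f -> L2 (W f) by move=> /WP [].
have Wdot f h : L2 f -> L2 h -> L2dot (Wadj k h) f = L2dot h (W f).
  by move=> /WP [_]; apply.
exists W; split; first split => //.
- move=> f g Lf Lg fg; apply: aeq_dotr_eq; [exact: WL|exact: WL|].
  move=> h Lh; rewrite -!Wdot//; apply: L2dot_aeq => //; try exact: Wadj_L2.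
  exact: aeq_refl.
- move=> c f g Lf Lg; have Lc := L2_lin c Lf Lg.
  apply: aeq_dotr_eq; [exact: WL|by apply: L2_lin; exact: WL|].
  move=> h Lh; have LW := WL _ Lf; have LW' := WL _ Lg; have Lk := Wadj_L2 Lh.
  rewrite -Wdot// !L2dotDr ?L2dotZr ?Wdot//; exact: L2Z.
(* [|W f|^2] is the pairing of [Wadj k (W f)] with [f], at most [|W f| |f|] since [Wadj k] is
   isometric. *)
- exists 1 => f Lf; rewrite mul1r !L2normE ler_wsqrtr//.
  have LW := WL _ Lf.
  have := cauchy_schwarz (Wadj_L2 LW) Lf; rewrite Wdot// (Wadj_isometry k0 LW).2 L2dotff.
  have -> : normc (nrm2 (W f))%:C = nrm2 (W f).
    by rewrite /= expr0n/= addr0 sqrtr_sqr ger0_norm ?nrm2_ge0.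
  have [->|n0] := eqVneq (nrm2 (W f)) 0; first by rewrite nrm2_ge0.
  by rewrite expr2 ler_pM2l// lt_def n0 nrm2_ge0.
- move=> n; apply: aeq_dotr_eq; [exact/WL/L2_zpow|exact: Wz_L2|].
  move=> h Lh; rewrite -Wdot//; last exact: L2_zpow.
  exact: Wadj_dot_zpow.
Qed.

Lemma WopP : is_Wop k (@Wop R k).
Proof. by rewrite /Wop; case: xgetP => [W -> //|]; have [W h] := Wop_exists => /(_ W). Qed.

Lemma Wop_L2 f : L2 f -> L2 (Wop k f).
Proof. by have [[h _ _ _] _] := WopP => /h. Qed.

(** [Wop k] is an unspecified operator satisfying [is_Wop], so the adjoint relation is derived from
    its values on the powers of [z]. *)
Lemma Wop_dot f h : L2 f -> L2 h -> L2dot (Wop k f) h = L2dot f (Wadj k h).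
Proof.
move=> Lf Lh; have [bW Wz_] := WopP.
have bW' : bounded_linear (orthc set0) L2 (@Wop R k).
  have [a b c [M d]] := bW; split.
  - by move=> g /orthc_set0; exact: a.
  - by move=> g g' /orthc_set0 Lg /orthc_set0; exact: b.
  - by move=> x g g' /orthc_set0 Lg /orthc_set0; exact: c.
  - by exists M => g /orthc_set0; exact: d.
have s0 : set0 `<=` (L2 : set (C -> C)) by [].
have [la ba] := bounded_linear_functional (fun _ => id) s0 Lh bW'.
have [lb bb] := L2dot_functional set0 (Wadj_L2 Lh).
apply: (functional_eq la ba lb bb) => // n.
have Lz := L2_zpow (R := R) n.
rewrite (L2dotC (Wadj_L2 Lh) Lz) Wadj_dot_zpow// -(L2dotC Lh (Wz_L2 n)).
by apply: L2dot_aeq; [exact: Wop_L2| |exact: Wz_L2| |exact: Wz_|exact: aeq_refl].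
Qed.

End Woperator.

(** * Hardy spaces *)

Section Hardy.
Context {R : realType}.
Local Notation C := R[i].
Local Notation mu := (@lebesgue_measure R).
Local Notation arc := (@Defs.arc R).
Implicit Types (a b f g h p q : C -> C) (m n : int).

Definition negative_powers : set (C -> C) := [set zpow n | n in [set n : int | n < 0]].

Lemma negative_powers_L2 : negative_powers `<=` L2.
Proof. by move=> _ [n _ <-]; exact: L2_zpow. Qed.

Lemma H2E : H2 = orthc negative_powers :> set (C -> C).
Proof.
apply/seteqP; split => f [Lf h]; split => //.
  by move=> _ [n n0 <-]; exact: h.
by move=> n n0; apply: h; exists n.
Qed.

Lemma H2_L2 f : H2 f -> L2 f.
Proof. by case. Qed.

Lemma H2_aeq f g : H2 f -> L2 g -> aeq f g -> H2 g.
Proof.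
move=> [Lf f0] Lg fg; split => // n /f0 <-.
apply: L2dot_aeq => //; try exact: L2_zpow.
  exact: aeq_sym.
exact: aeq_refl.
Qed.

Lemma H2_zpow n : 0 <= n -> H2 (zpow n : C -> C).
Proof.
move=> n0; split; first exact: L2_zpow.
by move=> m m0; rewrite L2dot_zpow gt_eqF// (lt_le_trans m0).
Qed.

Lemma H2_cst (c : C) : H2 (fun=> c).
Proof.
split; first exact: L2_cst.
move=> n n0; rewrite (@L2dot_ext _ _ _ (fun z => c * zpow 0 z) (zpow n)).
  by rewrite L2dotZ ?L2dot_zpow ?gt_eqF ?mulr0//; exact: L2_zpow.
by move=> z _; rewrite zpow0 mulr1.
Qed.

Lemma H2_eq f g : H2 f -> H2 g ->
  (forall n, 0 <= n -> L2dot f (zpow n) = L2dot g (zpow n)) -> aeq f g.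
Proof.
move=> [Lf f0] [Lg g0] fg; apply: L2_fourier_eq => // n.
by have [/fg//|n0] := leP 0 n; rewrite f0 ?g0.
Qed.

Lemma L2_zmul n f : L2 f -> L2 (fun z => zpow n z * f z).
Proof. exact/L2_bmul/Linf_zpow. Qed.

Lemma L2dot_zmul n f g :
  L2dot (fun z => zpow n z * f z) g = L2dot f (fun z => zpow (- n) z * g z).
Proof. by apply: L2dot_ext => z oz; rewrite cJM zpowJ// opprK; ring. Qed.

Lemma L2dot_zmul_zpow m n f :
  L2dot (fun z => zpow m z * f z) (zpow n) = L2dot f (zpow (n - m)).
Proof.
by apply: L2dot_ext => z oz; rewrite !zpowJ// opprB zpowD//; ring.
Qed.

Lemma H2_zmul n f : 0 <= n -> H2 f -> H2 (fun z => zpow n z * f z).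
Proof.
move=> n0 [Lf f0]; split; first exact: L2_zmul.
by move=> m m0; rewrite L2dot_zmul_zpow f0// subr_lt0 (lt_le_trans m0).
Qed.

(** Density of analytic polynomials in dual form: the projection of [u] onto H^2 has only zero
    coefficients. *)
Lemma H2_perp u p : L2 u -> (forall n, 0 <= n -> L2dot u (zpow n) = 0) ->
  H2 p -> L2dot u p = 0.
Proof.
move=> Lu u0 Hp.
have [P HP hP] := proj_exists negative_powers_L2 Lu.
rewrite -H2E in HP hP; have LP := H2_L2 HP; have Lp := H2_L2 Hp.
rewrite (L2dotC Lp Lu) -hP// -(L2dotC Lp LP).
have P0 : aeq P (fun=> 0).
  apply: H2_eq HP (H2_cst 0) _ => n n0; have Lz := @L2_zpow R n.
  by rewrite L2dot0 (L2dotC Lz LP) hP ?u0 -?(L2dotC Lz Lu) ?u0//; exact: H2_zpow.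
by rewrite -(L2dot0 p); apply: L2dot_aeq => //; [exact: L2_cst|exact: aeq_refl].
Qed.

(** The product is only integrable, so it is read as the pairing of [p] with the conjugate of
    [z^n q], which has only negative frequencies. *)
Lemma cint_H2_mul p q n : H2 p -> H2 q -> 0 < n ->
  cint (fun z => p z * q z * zpow n z) = 0.
Proof.
move=> Hp Hq n0; have Lp := H2_L2 Hp; have Lq := H2_L2 Hq.
pose u z := (zpow n z * q z)^*.
have Lu : L2 u by exact/L2J/L2_zmul.
have -> : cint (fun z => p z * q z * zpow n z) = L2dot p u.
  by apply: cint_ext => z _; rewrite /u cJK; ring.
rewrite (L2dotC Lu Lp) (H2_perp Lu) ?cJ0// => m m0.
have Lz := L2_zpow (R := R) (- (n + m)).
have -> : L2dot u (zpow m) = (L2dot q (zpow (- (n + m))))^*.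
  rewrite -(L2dotC Lq Lz); apply: L2dot_ext => z oz.
  by rewrite /u cJM !zpowJ// opprD zpowD//; ring.
by have [_ ->] := Hq; rewrite ?cJ0// oppr_lt0 ltr_wpDr.
Qed.

Lemma Hinf_H2 b : Hinf b -> H2 b.
Proof. by case. Qed.

Lemma Hinf_Linf b : Hinf b -> Linf b.
Proof. by case. Qed.

Lemma Hinf_mul b p : Hinf b -> H2 p -> H2 (fun z => b z * p z).
Proof.
move=> [Hb Bb] Hp; split; first exact/L2_bmul/H2_L2.
move=> n n0; rewrite -(cint_H2_mul Hb Hp (n := - n)) ?oppr_gt0//.
by apply: cint_ext => z oz; rewrite zpowJ.
Qed.

Lemma inner_Hinf a : is_inner a -> Hinf a.
Proof. by case. Qed.

Lemma inner_Linf a : is_inner a -> Linf a.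
Proof. by move=> /inner_Hinf []. Qed.

Lemma inner_L2 a : is_inner a -> L2 a.
Proof. by move=> /inner_Linf; exact: Linf_L2. Qed.

Lemma inner_unit a : is_inner a -> aeq (fun z => a z * (a z)^*) (fun=> 1).
Proof. by move=> [_ h]; apply: (aeS h) => t x /x /= y; rewrite mulcJ1. Qed.

Lemma is_innerP a : H2 a -> aeq (fun z => a z * (a z)^*) (fun=> 1) -> is_inner a.
Proof.
move=> Ha a1; have n1 : {ae mu, forall t, arc t -> normc (a (circ t)) = 1}.
  by apply: (aeS a1) => t x /x /= /normc_conj_eq1.
split=> //; split => //; split; first exact/L2_cmeas/H2_L2.
by exists 1; apply: (aeS n1) => t x /x ->.
Qed.

Lemma L2dot_aeqM f g f' g' : L2 f -> L2 g -> L2 f' -> L2 g' ->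
  aeq (fun z => f z * (g z)^*) (fun z => f' z * (g' z)^*) ->
  L2dot f g = L2dot f' g'.
Proof.
move=> Lf Lg Lf' Lg' h; apply: (cint_aeq (L2_CIdot Lf Lg) _ h).2.
exact/CI_cmeas/L2_CIdot.
Qed.

Lemma L2dot_inner a f g : is_inner a -> L2 f -> L2 g ->
  L2dot (fun z => a z * f z) (fun z => a z * g z) = L2dot f g.
Proof.
move=> ia Lf Lg; have Ba := inner_Linf ia.
apply: L2dot_aeqM => //; try exact: L2_bmul.
apply: (aeq_mono (inner_unit ia)) => z _ e.
by rewrite cJM -[RHS]mul1r -e; ring.
Qed.

Lemma inner_mul a b : is_inner a -> is_inner b -> is_inner (fun z => a z * b z).
Proof.
move=> ia ib; apply: is_innerP.
  by apply: Hinf_mul; [exact: inner_Hinf|exact/Hinf_H2/inner_Hinf].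
apply: (aeq_mono2 (inner_unit ia) (inner_unit ib)) => z _ e1 e2.
by rewrite cJM -[RHS]mulr1 -{1}e1 -e2; ring.
Qed.

Lemma inner_cancel a f g : is_inner a ->
  aeq (fun z => a z * f z) (fun z => a z * g z) -> aeq f g.
Proof.
move=> ia fg; apply: (aeq_mono2 (inner_unit ia) fg) => z _ e1 e2.
by rewrite -[LHS]mul1r -[RHS]mul1r -e1 mulrAC e2; ring.
Qed.

(** When [a] and its conjugate are both analytic, the coefficients of either sign vanish and only
    the mean of [a] survives. *)
Lemma conj_H2_constant a b : is_inner a -> H2 b ->
  aeq (fun z => (a z)^*) b -> is_constant a.
Proof.
move=> ia Hb ab; have La := inner_L2 ia; have Lb := H2_L2 Hb.
exists (L2dot a (zpow 0)); apply: L2_fourier_eq => //; first exact: L2_cst.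
move=> n; have Lz := L2_zpow (R := R) n.
have Lz0 := L2_zpow (R := R) 0; set c := L2dot a (zpow 0).
have -> : L2dot (fun=> c) (zpow n) = c * (0 == n)%:R.
  by rewrite -L2dot_zpow -L2dotZ//; apply: L2dot_ext => z _; rewrite zpow0 mulr1.
have [<-|n0] := eqVneq 0 n; first by rewrite mulr1.
rewrite mulr0; have [n1|n1] := ltP n 0; first by have [[_ h] _] := inner_Hinf ia; exact: h.
have -> : L2dot a (zpow n) = (L2dot (fun z => (a z)^*) (zpow (- n)))^*.
  rewrite -(L2dotC (L2J La) (L2_zpow (- n))); apply: L2dot_ext => z oz.
  by rewrite cJK zpowJ// mulrC.
rewrite (@L2dot_aeq _ _ _ b (zpow (- n)))//; try exact: L2_zpow.
- by have [_ ->] := Hb; rewrite ?cJ0// oppr_lt0 lt_def eq_sym n0.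
- exact: L2J.
- exact: aeq_refl.
Qed.

(** If [1 = a p1 + b p2], then [g b = a q] would give [conj(a) g = g p1 + q p2], without negative
    frequencies. Coprimality only puts 1 in the closure of [a H^2 + b H^2], so the argument is run
    in dual form, with the inner generator of that closure constructed as in Beurling's theorem. *)
Lemma coprime_divides a b g q : is_inner a -> is_inner b ->
  (forall t, is_inner t -> inner_dvd t a -> inner_dvd t b -> is_constant t) ->
  H2 g -> H2 q -> aeq (fun z => g z * b z) (fun z => a z * q z) ->
  H2 (fun z => (a z)^* * g z).
Proof.
move=> ia ib cop Hg Hq gb.
have La := inner_L2 ia; have Lb := inner_L2 ib.
have Ba := inner_Linf ia; have Bb := inner_Linf ib.
have Lg := H2_L2 Hg; have Lq := H2_L2 Hq.
(* [T] is the orthogonal complement of [a H^2 + b H^2] in L^2, so [M] is the closure of that sum. *)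
pose T : set (C -> C) := [set h | L2 h /\ forall p, H2 p ->
  L2dot h (fun z => a z * p z) = 0 /\ L2dot h (fun z => b z * p z) = 0].
pose M := orthc T.
have TL : T `<=` L2 by move=> h [].
have aM : M a.
  split => // h [Lh /(_ _ (H2_cst 1)) [h1 _]]; rewrite (L2dotC Lh La) -(@cJ0 R) -h1.
  by congr (_^*); apply: L2dot_ext => z _; rewrite mulr1.
have bM : M b.
  split => // h [Lh /(_ _ (H2_cst 1)) [_ h1]]; rewrite (L2dotC Lh Lb) -(@cJ0 R) -h1.
  by congr (_^*); apply: L2dot_ext => z _; rewrite mulr1.
have MH f : M f -> H2 f.
  move=> [Lf Tf]; split => // n n0; apply: Tf; split; first exact: L2_zpow.
  move=> p Hp; have Hap := Hinf_mul (inner_Hinf ia) Hp.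
  have Hbp := Hinf_mul (inner_Hinf ib) Hp.
  have Lz := L2_zpow (R := R) n.
  rewrite (L2dotC (H2_L2 Hap) Lz) (L2dotC (H2_L2 Hbp) Lz).
  by rewrite (Hap.2 _ n0) (Hbp.2 _ n0) !cJ0.
have zM n f : 0 <= n -> M f -> M (fun z => zpow n z * f z).
  move=> n0 [Lf Tf]; split; first exact: L2_zmul.
  move=> h [Lh Th]; rewrite L2dot_zmul; apply: Tf; split; first exact: L2_zmul.
  move=> p Hp; have [h1 h2] := Th _ (H2_zmul n0 Hp).
  rewrite !L2dot_zmul opprK; split.
    by rewrite -h1; apply: L2dot_ext => z _; congr (_ * (_)^*); ring.
  by rewrite -h2; apply: L2dot_ext => z _; congr (_ * (_)^*); ring.
(* The least such [n] is the smallest order of vanishing at 0 in [M]; it exists because [a] is in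
   [M] and is not 0. *)
have : exists n : nat, `[< exists2 f, M f & L2dot f (zpow n%:Z) != 0 >].
  apply: contrapT => none.
  have a0 : aeq a (fun=> 0).
    apply: H2_eq (MH _ aM) (H2_cst 0) _ => -[n|//] _; rewrite L2dot0.
    apply/eqP; apply: contrapT => /negP an; apply: none; exists n.
    by apply/asboolP; exists a.
  have := inner_unit ia; rewrite /aeq => a1.
  have L1 := L2_cst (1 : C); have L0 := L2_cst (0 : C).
  have : aeq (fun=> 1) ((fun=> 0) : C -> C).
    by apply: (aeq_mono2 (inner_unit ia) a0) => z _ <- ->; rewrite mul0r.
  move=> /(L2dot_aeq L1 (L2_zpow 0) L0 (L2_zpow 0)) /(_ (aeq_refl _)).
  rewrite L2dot0 => /eqP; rewrite (_ : L2dot _ _ = (0%Z == 0%Z)%:R) ?oner_eq0//.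
  by rewrite -L2dot_zpow; apply: L2dot_ext.
move=> exn; case: (ex_minnP exn) => n /asboolP [f0 Mf0 f0n] nmin.
have low f m : M f -> m < n%:Z -> L2dot f (zpow m) = 0.
  move=> Mf; have [m0 mn|m0 _] := leP 0 m; last by have [_ ->] := MH _ Mf.
  apply/eqP; apply: contrapT => /negP fm.
  have Pm : `[< exists2 f, M f & L2dot f (zpow `|m|%N%:Z) != 0 >].
    by apply/asboolP; exists f; rewrite ?gez0_abs.
  by have := nmin _ Pm; rewrite leqNgt -ltz_nat gez0_abs// mn.
(* The projection of [z^n] onto [M] is orthogonal to [z M], whose elements have no coefficient of
   index [n], and it is nonzero because [f0] has one. *)
have [t0 Mt0 dot0] := proj_exists TL (L2_zpow (R := R) n%:Z).
have Lt0 : L2 t0 by case: Mt0.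
have orth f j : M f -> 0 < j -> L2dot (fun z => zpow j z * f z) t0 = 0.
  move=> Mf j0; rewrite dot0; last by apply: zM => //; exact: ltW.
  by rewrite L2dot_zmul_zpow low// ltrBlDr ltrDl.
have c0 : 0 < nrm2 t0.
  rewrite lt_def nrm2_ge0 andbT; apply: contraNneq f0n => /(nrm2_eq0 Lt0) t00.
  have Lf0 : L2 f0 by case: Mf0.
  have L0 := L2_cst (0 : C).
  rewrite -dot0// (L2dot_aeq Lf0 Lt0 Lf0 L0 (aeq_refl _) t00).
  by rewrite (L2dotC L0 Lf0) L2dot0 cJ0.
(* The coefficients of [|t0|^2] are pairings of [z^j t0] with [t0]; those with [j != 0] vanish, so
   [|t0|] is constant and [t0] can be normalized to an inner function. *)
have sq : aeq (fun z => t0 z * (t0 z)^*) (fun=> (nrm2 t0)%:C).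
  have I1 := L2_CIdot Lt0 Lt0; have I2 := CI_cst (R := R) (- (nrm2 t0)%:C).
  have := fourier_unique (CID I1 I2); move=> h.
  apply: (aeq_mono (h _)) => [j|z _ /eqP]; last first.
    by rewrite subr_eq0 => /eqP.
  rewrite (@cint_ext _ _ (fun z => zpow j z * (t0 z * (t0 z)^*) +
      (- (nrm2 t0)%:C) * zpow j z)); last by move=> z _; ring.
  rewrite cintD; [|exact: CI_bmul (Linf_zpow j) I1|exact/CIZ/L2_CI/L2_zpow].
  rewrite cintZ; last exact/L2_CI/L2_zpow.
  have e : cint (fun z => zpow j z * (t0 z * (t0 z)^*)) =
      L2dot (fun z => zpow j z * t0 z) t0.
    by apply: cint_ext => z _; rewrite mulrA.
  rewrite cint_zpow; have [->|j0] := eqVneq j 0.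
    rewrite mulr1 (_ : cint _ = (nrm2 t0)%:C) ?subrr// -L2dotff.
    by apply: cint_ext => z _; rewrite zpow0 mul1r.
  rewrite mulr0 addr0 e; have [jp|jn] := ltP 0 j; first exact: orth.
  have jn' : 0 < - j by rewrite oppr_gt0 lt_def eq_sym j0.
  rewrite L2dot_zmul (L2dotC (L2_zmul (- j) Lt0) Lt0).
  by rewrite orth ?cJ0.
pose s := Num.sqrt (nrm2 t0).
have s0 : s != 0 by rewrite gt_eqF// sqrtr_gt0.
have ss : s ^+ 2 = nrm2 t0 by rewrite sqr_sqrtr// ltW.
pose t z := (s^-1)%:C * t0 z.
have Mt : M t by exact: orthcZ.
have it : is_inner t.
  apply: is_innerP; first exact: MH.
  apply: (aeq_mono sq) => z _ e; rewrite /t cJM cJr.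
  transitivity ((s^-1)%:C * (s^-1)%:C * (t0 z * (t0 z)^*)); first by ring.
  rewrite e -ss -!real_complexM expr2 mulrA -[s^-1 * s^-1 * s]mulrA mulVf//.
  by rewrite mulr1 mulVf.
have Bt := inner_Linf it.
(* The negative coefficients of [conj(t) f] are, up to scaling, pairings of some [z^j f], [j > 0],
   with [t0]. *)
have quot f : M f -> H2 (fun z => (t z)^* * f z).
  move=> Mf; have Lf : L2 f by case: Mf.
  split; first by apply: L2_bmul => //; exact: LinfJ.
  move=> m m0.
  have -> : L2dot (fun z => (t z)^* * f z) (zpow m) =
      L2dot (fun z => (s^-1)%:C * (zpow (- m) z * f z)) t0.
    by apply: L2dot_ext => z oz; rewrite /t cJM cJr zpowJ//; ring.
  by rewrite L2dotZ ?orth ?mulr0 ?oppr_gt0//; exact: L2_zmul.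
clearbody t.
have dvd f : M f -> is_inner f -> inner_dvd t f.
  move=> Mf jf; exists (fun z => (t z)^* * f z).
    apply: is_innerP; first exact: quot.
    apply: (aeq_mono2 (inner_unit it) (inner_unit jf)) => z _ e1 e2.
    by rewrite cJM cJK -[RHS]mulr1 -{1}e1 -e2; ring.
  apply: (aeq_mono (inner_unit it)) => z _ e1.
  by rewrite mulrA e1 mul1r.
(* As a common divisor of [a] and [b], [t] is constant, and nonzero since its norm is 1; hence [T]
   is orthogonal to 1. *)
have [d td] := cop t it (dvd a aM ia) (dvd b bM ib).
have d0 : d != 0.
  apply/eqP => d0; have := nrm2_aeq (inner_L2 it) (L2_cst d) td.
  have -> : nrm2 t = 1.
    apply: complexI; rewrite -L2dotff.
    have := L2dot_inner it (L2_cst 1) (L2_cst 1).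
    rewrite (_ : L2dot (fun=> 1) (fun=> 1) = (0%Z == 0%Z)%:R); last first.
      by rewrite -L2dot_zpow; apply: L2dot_ext.
    move=> e; transitivity ((0%Z == 0%Z)%:R : C); last by [].
    by rewrite -e; apply: L2dot_ext => z _; rewrite !mulr1.
  rewrite d0 => /(congr1 (fun x => x%:C)); rewrite -L2dotff L2dot0 => -[] /eqP.
  by rewrite oner_eq0.
have one h : T h -> L2dot (fun=> 1) h = 0.
  move=> Th; have Lh := TL _ Th; have [Lt /(_ _ Th) th] := Mt.
  apply: (mulfI d0); rewrite mulr0 -th -(L2dotZ d (L2_cst 1) Lh).
  have Ld := L2Z d (L2_cst (1 : C)).
  apply: L2dot_aeq => //; last exact: aeq_refl.
  by apply: (aeq_mono (aeq_sym td)) => z _ <-; rewrite mulr1.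
have LaJ := L2_bmul (LinfJ Ba) Lg.
split => // m m0.
(* The pairing of 1 with [h] is the coefficient of index [m] of [conj(a) g]. Moreover [h] lies in
   [T]: against [a p] the factor [a] cancels and [g p] remains, and against [b p] one uses
   [a conj(g b) = conj(q)]. *)
pose h z := a z * (zpow (- m) z * g z)^*.
have mp : 0 < - m by rewrite oppr_gt0.
have Lzg := L2_zmul (- m) Lg.
have Th : T h.
  have Lh : L2 h by exact/L2_bmul/L2J.
  split => // p Hp; have Lp := H2_L2 Hp.
  have Lap := L2_bmul Ba Lp; have Lbp := L2_bmul Bb Lp; split.
    have -> : L2dot h (fun z => a z * p z) = L2dot (fun z => (zpow (- m) z * g z)^*) p.
      by rewrite L2dot_inner//; exact: L2J.
    rewrite -(@cJ0 R) -(cint_H2_mul Hg Hp mp) -cintJ.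
      by apply: cint_ext => z _; rewrite !cJM; ring.
    apply: CI_ext (CI_bmul (Linf_zpow (- m)) (L2_mul Lg Lp)) => z _; ring.
  rewrite -(@cJ0 R) -(cint_H2_mul Hq Hp mp) -cintJ; last first.
    apply: CI_ext (CI_bmul (Linf_zpow (- m)) (L2_mul Lq Lp)) => z _; ring.
  apply: (cint_aeq (L2_CIdot Lh Lbp) _ _).2.
    apply: cmeasJ; apply: cmeasM; last exact: cmeas_zpow.
    by apply: cmeasM; exact: L2_cmeas.
  apply: (aeq_mono2 (inner_unit ia) gb) => z _ e1 e2.
  rewrite /h !cJM.
  transitivity ((zpow (- m) z)^* * (p z)^* * a z * ((g z * b z)^*)); first by rewrite cJM; ring.
  rewrite e2 cJM; transitivity ((a z * (a z)^*) * ((q z)^* * (p z)^* * (zpow (- m) z)^*)).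
    by ring.
  by rewrite e1 mul1r.
have Lh : L2 h := TL _ Th.
rewrite -(one h Th); apply: L2dot_ext => z oz.
by rewrite /h !cJM !cJK zpowJ//; ring.
Qed.

End Hardy.

(** * Model spaces *)

Section ModelSpace.
Context {R : realType}.
Local Notation C := R[i].
Implicit Types (a b f g h p q u : C -> C).

(** Presents K_a in the form [orthc S], to which the Riesz and projection theorems apply. *)
Definition model_compl a : set (C -> C) :=
  negative_powers `|` [set (fun z => a z * h z) | h in H2].

Lemma model_compl_L2 a : Linf a -> model_compl a `<=` L2.
Proof.
move=> Ba h [/negative_powers_L2//|[p Hp <-]].
exact/L2_bmul/H2_L2.
Qed.

Lemma modelE a : model a = orthc (model_compl a).
Proof.
apply/seteqP; split => f.
  move=> [[Lf f0] fa]; split => // h [[n n0 <-]|[p Hp <-]]; [exact: f0|exact: fa].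
move=> [Lf fh]; split; first by split => // n n0; apply: fh; left; exists n.
by move=> p Hp; apply: fh; right; exists p.
Qed.

Lemma model_H2 a f : model a f -> H2 f.
Proof. by case. Qed.

Lemma model_L2 a f : model a f -> L2 f.
Proof. by move=> /model_H2 /H2_L2. Qed.

Lemma model_lin a (c : C) f g : Linf a -> model a f -> model a g ->
  model a (fun z => c * f z + g z).
Proof. by move=> Ba; rewrite modelE; apply: orthc_lin; exact: model_compl_L2. Qed.

Lemma model_dot_eq a p q : Linf a -> model a p -> model a q ->
  (forall h, model a h -> L2dot h p = L2dot h q) -> aeq p q.
Proof.
move=> Ba Kp Kq pq; have Lp := model_L2 Kp; have Lq := model_L2 Kq.
pose d z := -1 * q z + p z.
have Kd : model a d by exact: model_lin.
have Ld := model_L2 Kd.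
have dE : d = fun z => p z - q z by apply/funext => z; rewrite /d mulN1r addrC.
have /(nrm2_eq0 Ld) d0 : nrm2 d = 0.
  apply: complexI; rewrite -L2dotff {2}dE L2dotBr// pq// subrr//.
apply: (aeq_mono d0) => z _; rewrite dE => /eqP; rewrite subr_eq0 => /eqP; exact.
Qed.

Lemma orthproj_modelP a f : Linf a -> L2 f ->
  model a (orthproj (model a) f) /\
  forall h, model a h -> L2dot h (orthproj (model a) f) = L2dot h f.
Proof.
move=> Ba Lf; rewrite /orthproj; case: xgetP => [p _ [Kp pP]|none].
  split => // h Kh; have Lp := model_L2 Kp; have Lh := model_L2 Kh.
  have := pP h Kh; rewrite L2dotB// => /eqP; rewrite subr_eq0 => /eqP e.
  by rewrite (L2dotC Lp Lh) -e -(L2dotC Lf Lh).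
have [p Kp hp] := proj_exists (model_compl_L2 Ba) Lf.
rewrite -modelE in Kp hp; exfalso; apply: (none p); split => // h Kh.
have Lp := model_L2 Kp; have Lh := model_L2 Kh.
by rewrite L2dotB// (L2dotC Lh Lf) -hp// -(L2dotC Lh Lp) subrr.
Qed.

Lemma orthproj_model_eq a f p : Linf a -> L2 f -> model a p ->
  (forall h, model a h -> L2dot (fun z => f z - p z) h = 0) ->
  aeq p (orthproj (model a) f).
Proof.
move=> Ba Lf Kp pP; have [KP hP] := orthproj_modelP Ba Lf.
apply: (model_dot_eq Ba) => // h Kh; have Lp := model_L2 Kp; have Lh := model_L2 Kh.
rewrite hP//; have := pP h Kh; rewrite L2dotB// => /eqP; rewrite subr_eq0 => /eqP e.
by rewrite (L2dotC Lp Lh) -e -(L2dotC Lf Lh).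
Qed.

(** The backward shift [(u - u(0)) / z]: the pairing with [zpow 0] is the value at 0 of the analytic
    extension when [u] is in H^2. *)
Definition backshift u : C -> C :=
  fun z => zpow (-1) z * (u z - L2dot u (zpow 0)).

Lemma backshift_L2 u : L2 u -> L2 (backshift u).
Proof. by move=> Lu; apply: L2_zmul; apply: L2B => //; exact: L2_cst. Qed.

Lemma L2dot_backshift u g : H2 u -> H2 g ->
  L2dot g (backshift u) = L2dot (fun z => zpow 1 z * g z) u.
Proof.
move=> Hu Hg; have Lu := H2_L2 Hu; have Lg := H2_L2 Hg.
pose c := L2dot u (zpow 0); have Lc : L2 (fun=> c) by exact: L2_cst.
have -> : L2dot g (backshift u) =
    L2dot (fun z => zpow 1 z * g z) (fun z => u z - c) by rewrite L2dot_zmul.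
rewrite L2dotBr//; last exact: L2_zmul.
have -> : L2dot (fun z => zpow 1 z * g z) (fun=> c) =
    L2dot (fun z => c^* * (zpow 1 z * g z)) (zpow 0).
  by apply: L2dot_ext => z _; rewrite zpow0 cJ1; ring.
rewrite L2dotZ; [|exact: L2_zmul|exact: L2_zpow].
rewrite L2dot_zmul_zpow sub0r; have [_ ->] := Hg => //.
by rewrite mulr0 subr0.
Qed.

Lemma backshift_H2 u : H2 u -> H2 (backshift u).
Proof.
move=> Hu; have Lu := H2_L2 Hu; split; first exact: backshift_L2.
move=> n n0; rewrite L2dot_zmul_zpow opprK L2dotB//; [|exact: L2_cst|exact: L2_zpow].
have -> : L2dot (fun=> L2dot u (zpow 0)) (zpow (n + 1)) =
    L2dot (fun z => L2dot u (zpow 0) * zpow 0 z) (zpow (n + 1)).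
  by apply: L2dot_ext => z _; rewrite zpow0 mulr1.
rewrite L2dotZ ?L2dot_zpow; [|exact: L2_zpow|exact: L2_zpow].
have [->|n1] := eqVneq n (-1); first by rewrite addNr eqxx mulr1 subrr.
have n2 : n + 1 < 0 by lia.
by rewrite gt_eqF// mulr0 subr0; have [_ ->] := Hu.
Qed.

Lemma backshift_Hinf u : Hinf u -> Hinf (backshift u).
Proof.
move=> [Hu Bu]; split; first exact: backshift_H2.
apply: LinfM; first exact: Linf_zpow.
by apply: LinfD => //; exact: Linf_cst.
Qed.

Lemma mul_zpow0 a : (fun z => a z * zpow 0 z) = a.
Proof. by apply/funext => z; rewrite zpow0 mulr1. Qed.

Lemma backshift_model a u : is_inner a -> model a u -> model a (backshift u).
Proof.
move=> ia [Hu ua]; split; first exact: backshift_H2.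
move=> h Hh; have Hah := Hinf_mul (inner_Hinf ia) Hh.
have Lb := backshift_L2 (H2_L2 Hu).
rewrite (L2dotC (H2_L2 Hah) Lb) L2dot_backshift//.
rewrite -(L2dotC (L2_zmul 1 (H2_L2 Hah)) (H2_L2 Hu)).
rewrite -(ua _ (H2_zmul ler01 Hh)).
by apply: L2dot_ext => z _; congr (_ * (_)^*); ring.
Qed.

Lemma backshift_inner a : is_inner a -> model a (backshift a).
Proof.
move=> ia; have Ha := Hinf_H2 (inner_Hinf ia); have La := inner_L2 ia.
split; first exact: backshift_H2.
move=> h Hh; have Hah := Hinf_mul (inner_Hinf ia) Hh.
have Lb := backshift_L2 La; have Lh := H2_L2 Hh.
rewrite (L2dotC (H2_L2 Hah) Lb) L2dot_backshift// -(@cJ0 R); congr (Num.conj _).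
transitivity (L2dot (fun z => zpow 1 z * h z) (zpow 0)); last first.
  by rewrite L2dot_zmul_zpow; have [_ ->] := Hh.
rewrite -(L2dot_inner ia (L2_zmul 1 Lh) (L2_zpow 0)) mul_zpow0.
by apply: L2dot_ext => z _; congr (_ * _); ring.
Qed.

(** The backward shift meets the specification under [xget], and the specification determines its
    solution in K_a up to null sets. *)
Lemma cshift_adjP a f : is_inner a -> model a f ->
  model a (cshift_adj a f) /\ aeq (cshift_adj a f) (backshift f).
Proof.
move=> ia Kf; have Ba := inner_Linf ia.
have Kb := backshift_model ia Kf; have Lf := model_L2 Kf.
have shift_dot g : model a g -> L2dot (cshift a g) f = L2dot g (backshift f).
  move=> Kg; have Hg := model_H2 Kg; have Lg := H2_L2 Hg.
  have Lzg : L2 (fun z => z * g z) by exact: (L2_zmul 1 Lg).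
  have [KP hP] := orthproj_modelP Ba Lzg.
  rewrite (L2dot_backshift (model_H2 Kf) Hg) /cshift (L2dotC Lf (model_L2 KP)).
  by rewrite hP// -(L2dotC Lf Lzg).
rewrite /cshift_adj /adjoint; case: xgetP => [h _ [Kh hP]|none]; last first.
  by exfalso; apply: (none (backshift f)).
split => //; apply: (model_dot_eq Ba) => // g Kg.
by rewrite -hP// shift_dot.
Qed.

Lemma cshift_adj_dot a f g : is_inner a -> model a f -> H2 g ->
  L2dot (cshift_adj a f) g = L2dot f (fun z => zpow 1 z * g z).
Proof.
move=> ia Kf Hg; have [KS Sb] := cshift_adjP ia Kf.
have Lg := H2_L2 Hg; have Lf := model_L2 Kf; have Lb := backshift_L2 Lf.
rewrite (L2dot_aeq (model_L2 KS) Lg Lb Lg Sb (aeq_refl g)).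
rewrite (L2dotC Lg Lb) (L2dot_backshift (model_H2 Kf) Hg).
by rewrite -L2dotC//; exact: L2_zmul.
Qed.

Lemma iter_cshift_adjP a f m : is_inner a -> model a f ->
  model a (iter m (cshift_adj a) f) /\
  forall g, H2 g ->
    L2dot (iter m (cshift_adj a) f) g = L2dot f (fun z => zpow m%:Z z * g z).
Proof.
move=> ia Kf; elim: m => [|m [K IH]] /=.
  by split => // g Hg; apply: L2dot_ext => z _; rewrite zpow0 mul1r.
split; first by case: (cshift_adjP ia K).
move=> g Hg; rewrite cshift_adj_dot// IH; last exact: H2_zmul.
apply: L2dot_ext => z oz; congr (_ * (_)^*); rewrite mulrA -zpowD//.
by rewrite -addn1 PoszD.
Qed.

Lemma cshift_adj_aeq a f g : is_inner a -> model a f -> model a g -> aeq f g ->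
  aeq (cshift_adj a f) (cshift_adj a g).
Proof.
move=> ia Kf Kg fg; have [K1 _] := cshift_adjP ia Kf.
have [K2 _] := cshift_adjP ia Kg.
apply: H2_eq (model_H2 K1) (model_H2 K2) _ => n n0; have Hz := H2_zpow (R := R) n0.
rewrite !cshift_adj_dot//; apply: L2dot_aeq; try exact: model_L2 _.
- exact: model_L2 Kf.
- exact/L2_zmul/L2_zpow.
- exact: model_L2 Kg.
- exact/L2_zmul/L2_zpow.
- exact: fg.
- exact: aeq_refl.
Qed.

(** These iterates are [P_+(zbar^m a)]. The inner function itself is bounded but not in K_a, hence
    the condition [0 < m]. *)
Lemma iter_backshift_inner a m : is_inner a ->
  [/\ Hinf (iter m backshift a), (0 < m)%N -> model a (iter m backshift a) &
    forall g, H2 g -> L2dot g (iter m backshift a) =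
      L2dot (fun z => zpow m%:Z z * g z) a].
Proof.
move=> ia; elim: m => [|m [Hm Km IH]] /=.
  split; [exact: inner_Hinf|by []|].
  by move=> g Hg; apply: L2dot_ext => z _; rewrite zpow0 mul1r.
split; first exact: backshift_Hinf.
  move=> _; case: m Hm Km {IH} => [|m] Hm Km /=; first exact: backshift_inner.
  exact/backshift_model/Km.
move=> g Hg; rewrite L2dot_backshift//; last exact: Hinf_H2.
rewrite IH; last exact: H2_zmul.
apply: L2dot_ext => z oz; congr (_ * _); rewrite mulrA -zpowD//.
by rewrite -addn1 PoszD.
Qed.

(* The functions [P_+(zbar^m a)], [0 < m], are bounded and span [model a]. *)
Lemma separated_by_model_inf a g : is_inner a -> H2 g ->
  (forall f, model_inf a f -> L2dot g f = 0) -> H2 (fun z => (a z)^* * g z).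
Proof.
move=> ia Hg gf; have Lg := H2_L2 Hg; have La := inner_L2 ia.
split; first by apply: L2_bmul => //; exact/LinfJ/inner_Linf.
move=> n n0; have [m m0 mE] : exists2 m : nat, (0 < m)%N & n = - m%:Z.
  by exists `|n|%N; [rewrite absz_gt0 lt_eqF|rewrite ltz0_abs// opprK].
have [Hm Km dm] := iter_backshift_inner m ia.
rewrite -(gf (iter m backshift a)); last by split; [exact: Km|].
rewrite dm//; apply: L2dot_ext => z oz; rewrite mE zpowJ// opprK; ring.
Qed.

(** Orthogonality to the bounded elements puts [conj(a) f] in H^2, while [f] orthogonal to [a H^2]
    kills its coefficients of nonnegative index. *)
Lemma model_inf_dense a f : is_inner a -> model a f ->
  (forall h, model_inf a h -> L2dot f h = 0) -> aeq f (fun=> 0).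
Proof.
move=> ia Kf fh; have Hq := separated_by_model_inf ia (model_H2 Kf) fh.
have q0 : aeq (fun z => (a z)^* * f z) (fun=> 0).
  apply: H2_eq Hq (H2_cst 0) _ => n n0; rewrite L2dot0.
  have [_ fa] := Kf; rewrite -(fa _ (H2_zpow n0)).
  by apply: L2dot_ext => z _; rewrite cJM; ring.
apply: (aeq_mono2 q0 (inner_unit ia)) => z _ e1 e2.
by rewrite -[LHS]mul1r -e2 -mulrA e1 mulr0.
Qed.

Lemma model_functional_eq a (l1 l2 : (C -> C) -> C) : is_inner a ->
  linear_on (model_compl a) l1 -> bounded_on (model_compl a) l1 ->
  linear_on (model_compl a) l2 -> bounded_on (model_compl a) l2 ->
  (forall f, model_inf a f -> l1 f = l2 f) ->
  forall f, model a f -> l1 f = l2 f.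
Proof.
move=> ia lin1 b1 lin2 b2 l12 f Kf.
have Ba := inner_Linf ia; have SL := model_compl_L2 Ba.
have [x1 K1 h1] := riesz SL lin1 b1.
have [x2 K2 h2] := riesz SL lin2 b2.
rewrite -modelE in K1 K2 h1 h2.
have L1 := model_L2 K1; have L2' := model_L2 K2; have Lf := model_L2 Kf.
rewrite h1 ?h2//; apply: L2dot_aeq => //; first exact: aeq_refl.
pose d z := -1 * x2 z + x1 z.
have Kd : model a d by exact: model_lin.
have dE : d = fun z => x1 z - x2 z by apply/funext => z; rewrite /d mulN1r addrC.
have d0 : aeq d (fun=> 0).
  apply: (model_inf_dense ia Kd) => h Kh; have [Kh' _] := Kh.
  have Lh := model_L2 Kh'; rewrite dE L2dotB// (L2dotC Lh L1) (L2dotC Lh L2').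
  by rewrite -h1// -h2// l12// subrr.
by apply: (aeq_mono d0) => z _; rewrite dE => /eqP; rewrite subr_eq0 => /eqP.
Qed.

(** The standard conjugation of K_a, which exchanges the two orthogonality conditions that define
    the space. *)
Lemma model_conj a h : is_inner a -> model a h ->
  model a (fun z => a z * (zpow 1 z * h z)^*).
Proof.
move=> ia [Hh ha]; have Ba := inner_Linf ia; have Lh := H2_L2 Hh.
have Lu := L2J (L2_zmul 1 Lh).
have Lau := L2_bmul Ba Lu; split.
  split => // n n0; have n1 : 0 <= - n - 1 by lia.
  have Laz := L2_bmul Ba (L2_zpow (R := R) (- n - 1)).
  rewrite -(@cJ0 R) -(ha _ (H2_zpow n1)) -L2dotC//.
  apply: L2dot_ext => z oz; rewrite cJM !zpowJ//.
  by rewrite (_ : zpow (- n - 1) z = zpow (- n) z * zpow (-1) z) ?zpowD//; ring.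
move=> p Hp; have Lp := H2_L2 Hp.
rewrite L2dot_inner// -(@cJ0 R) -(cint_H2_mul Hh Hp (n := 1))// -cintJ.
  by apply: cint_ext => z _; rewrite !cJM; ring.
by apply: CI_ext (CI_bmul (Linf_zpow 1) (L2_mul Lh Lp)) => z _; ring.
Qed.

End ModelSpace.

(** * Symbols of intertwining operators *)

Section Symbols.
Context {R : realType}.
Local Notation C := R[i].
Implicit Types (a b f g h p q phi alpha beta gamma : C -> C).

(** If [t] divides both quotients, [gamma t] divides [gamma], so [t w = 1] with [w] inner; then the
    conjugate of [t] is the analytic function [w]. *)
Lemma gcd_quotients_coprime alpha omega gamma a1 b1 t :
  is_inner_gcd alpha omega gamma -> is_inner a1 -> is_inner b1 ->
  aeq alpha (fun z => gamma z * a1 z) -> aeq omega (fun z => gamma z * b1 z) ->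
  is_inner t -> inner_dvd t a1 -> inner_dvd t b1 -> is_constant t.
Proof.
move=> [ig _ _ gmax] ia ib ea eb it [u iu au] [v iv bv].
have igt := inner_mul ig it.
have [||w iw gw] := gmax _ igt.
- exists u => //; apply: (aeq_mono2 ea au) => z _ -> ->; ring.
- exists v => //; apply: (aeq_mono2 eb bv) => z _ -> ->; ring.
have tw : aeq (fun=> 1) (fun z => t z * w z).
  apply: (inner_cancel ig); apply: (aeq_mono gw) => z _ e.
  by rewrite mulr1 {1}e mulrA.
apply: (conj_H2_constant it (Hinf_H2 (inner_Hinf iw))).
apply: (aeq_mono2 tw (inner_unit it)) => z _ e1 e2.
by rewrite -[LHS]mulr1 e1 mulrA [_^* * _]mulrC e2 mul1r.
Qed.

(** Conjugating [conj(alpha) z h] gives [a1] times [gamma conj(z h)], the image of [h] under the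
    conjugation of K_gamma. *)
Lemma conj_z_modelP alpha gamma a1 phi : is_inner alpha -> is_inner gamma ->
  is_inner a1 -> aeq alpha (fun z => gamma z * a1 z) ->
  conj_z_model alpha gamma phi <->
  L2 phi /\ exists2 g1, model gamma g1 &
    aeq (fun z => (phi z)^*) (fun z => a1 z * g1 z).
Proof.
move=> ia ig ia1 ea; split => -[Lphi [h Kh e]]; split => //;
    exists (fun z => gamma z * (zpow 1 z * h z)^*); try exact: model_conj.
  apply: (aeq_mono2 e ea) => z oz -> ->.
  by rewrite !cJM !cJK zpow1; ring.
apply: (aeq_mono3 e ea (inner_unit ig)) => z oz e1 -> e3.
rewrite -[LHS]cJK e1 !cJM zpowJ// -[LHS]mul1r.
transitivity ((gamma z * (gamma z)^*) * (zpow (-1) z * zpow 1 z) *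
  ((a1 z)^* * (h z)^*)); last by rewrite zpow1; ring.
by rewrite e3 -zpowD// addNr zpow0 !mul1r.
Qed.

Section Operator.
Variables (k : nat) (alpha beta phi : C -> C) (U : (C -> C) -> C -> C).
Hypotheses (k0 : (0 < k)%N) (ia : is_inner alpha) (ib : is_inner beta).
Hypothesis Lphi : L2 phi.
Hypothesis bU : bounded_linear (model alpha) (model beta) U.

Let g z := (phi z)^*.

Let Lg : L2 g.
Proof. exact: L2J. Qed.

Let UK f : model alpha f -> model beta (U f).
Proof. by case: bU => h _ _ _; exact: h. Qed.

Let UL2 f : model alpha f -> L2 (U f).
Proof. by move=> /UK /model_L2. Qed.

Lemma symbol_mul_L2 f : model_inf alpha f -> L2 (fun z => phi z * f z).
Proof.
move=> [_ [_ Bf]]; apply: L2_ext (L2_bmul Bf Lphi) => z _; exact: mulrC.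
Qed.

Lemma Wop_symbol_dot f p : model_inf alpha f -> L2 p ->
  L2dot (Wop k (fun z => phi z * f z)) p =
  L2dot (fun z => phi z * f z) (Wadj k p).
Proof. by move=> Kf Lp; apply: Wop_dot => //; exact: symbol_mul_L2. Qed.

Lemma Wop_symbol_coef f n : model_inf alpha f ->
  L2dot (Wop k (fun z => phi z * f z)) (zpow n) =
  L2dot f (fun z => zpow (k%:Z * n) z * g z).
Proof.
move=> Kf; rewrite Wop_symbol_dot//; last exact: L2_zpow.
by apply: L2dot_ext => z oz; rewrite Wadj_zpow// /g cJM cJK; ring.
Qed.

Lemma functional_U p : L2 p ->
  linear_on (model_compl alpha) (fun f => L2dot (U f) p) /\
  bounded_on (model_compl alpha) (fun f => L2dot (U f) p).
Proof.
move=> Lp; have := bU; rewrite [model alpha]modelE => bU'.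
apply: (bounded_linear_functional _ _ Lp bU').
  by move=> h; exact: model_L2.
exact/model_compl_L2/inner_Linf.
Qed.

(** * From the coefficient formula to the symbol and its divisibility *)

Section Necessity.
(** A weak form of [U f = P_+ W_k (phi f)] that is meaningful for unbounded [f] as well. *)
Hypothesis coefU : forall f n, model alpha f -> 0 <= n ->
  L2dot (U f) (zpow n) = L2dot f (fun z => zpow (k%:Z * n) z * g z).

Lemma U_sub_Wop_perp f p : model_inf alpha f -> H2 p ->
  L2dot (fun z => Wop k (fun z => phi z * f z) z - U f z) p = 0.
Proof.
move=> Kf; have [Kf' _] := Kf.
have LW : L2 (Wop k (fun z => phi z * f z)) by exact/Wop_L2/symbol_mul_L2.
have LU := UL2 Kf'.
apply: H2_perp; first exact: L2B.
move=> n n0; rewrite L2dotB//; last exact: L2_zpow.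
by rewrite Wop_symbol_coef// coefU// subrr.
Qed.

Lemma has_symbol_of_coef : has_symbol k alpha beta phi U.
Proof.
move=> f Kf; have [Kf' _] := Kf.
apply: orthproj_model_eq.
- exact: inner_Linf.
- exact/Wop_L2/symbol_mul_L2.
- exact: UK.
- by move=> h /model_H2; exact: U_sub_Wop_perp.
Qed.

(** Since [U f] is orthogonal to [beta], moving [W_k] to the other side shows that [b g] is
    orthogonal to every bounded [f] in K_alpha. Here [b] is a version of [beta(z^k)] known to be in
    [Hinf], such as [gamma b1]. *)
Lemma symbol_divisible b : H2 g -> Hinf b -> aeq (Wadj k beta) b ->
  H2 (fun z => (alpha z)^* * (b z * g z)).
Proof.
move=> Hg Hb eb; have HG := Hinf_mul Hb Hg.
apply: separated_by_model_inf => // f Kf; have [Kf' _] := Kf.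
have Lb := Linf_L2 (Hinf_Linf Hb); have Lbeta := inner_L2 ib.
have LU := UL2 Kf'; have LW := Wop_L2 k0 (symbol_mul_L2 Kf).
have Lf := model_L2 Kf'.
have Ub : L2dot (U f) beta = 0.
  have [_ /(_ _ (H2_cst 1)) <-] := UK Kf'.
  by apply: L2dot_ext => z _; rewrite mulr1.
have := U_sub_Wop_perp Kf (Hinf_H2 (inner_Hinf ib)).
rewrite L2dotB// Ub subr0 Wop_symbol_dot// => W0.
rewrite (L2dotC Lf (H2_L2 HG)) -(@cJ0 R) -W0; congr (Num.conj _).
have LWb := Wadj_L2 k0 Lbeta; have Lp := symbol_mul_L2 Kf.
rewrite [RHS](L2dot_aeq Lp LWb Lp Lb (aeq_refl _) eb).
by apply: L2dot_ext => z _; rewrite /g cJM cJK; ring.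
Qed.

End Necessity.

(** * From the symbol back to the intertwining relation *)

Section Sufficiency.
Hypothesis symU : has_symbol k alpha beta phi U.
Variables (a1 b1 g1 : C -> C).
Hypothesis eg : aeq g (fun z => a1 z * g1 z).
Hypothesis ea : aeq (fun z => a1 z * Wadj k beta z) (fun z => alpha z * b1 z).
Hypotheses (Hg1 : H2 g1) (Hb1 : Hinf b1).

(** Divisibility makes [P_+ w] orthogonal to [beta H^2], so projecting [w] onto K_beta only removes
    its negative frequencies, and the coefficients of index [n >= 0] are those of [w]. *)
Lemma coef_of_has_symbol f n : model_inf alpha f -> 0 <= n ->
  L2dot (U f) (zpow n) = L2dot f (fun z => zpow (k%:Z * n) z * g z).
Proof.
move=> Kf n0; have [Kf' _] := Kf; have Lf := model_L2 Kf'.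
have Lpf := symbol_mul_L2 Kf.
set w := Wop k (fun z => phi z * f z).
have Lw : L2 w by exact: Wop_L2.
have [v] := proj_exists negative_powers_L2 Lw; rewrite -H2E => Hv vP.
have Lv := H2_L2 Hv.
have vdot h : H2 h -> L2dot v h = L2dot w h.
  by move=> Hh; have Lh := H2_L2 Hh; rewrite (L2dotC Lh Lv) vP// -L2dotC.
have Bb := inner_Linf ib.
have Kv : model beta v.
  split => // p Hp.
  have -> : L2dot v (fun z => beta z * p z) =
      L2dot (fun z => (beta z)^* * v z) p.
    by apply: L2dot_ext => z _; rewrite cJM; ring.
  apply: H2_perp Hp; first by apply: L2_bmul => //; exact: LinfJ.
  move=> m m0; have Lz := L2_zpow (R := R) m.
  have Hbz := Hinf_mul (inner_Hinf ib) (H2_zpow (R := R) m0).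
  have -> : L2dot (fun z => (beta z)^* * v z) (zpow m) =
      L2dot v (fun z => beta z * zpow m z).
    by apply: L2dot_ext => z _; rewrite cJM; ring.
  rewrite vdot// /w Wop_symbol_dot//; last exact: H2_L2.
  have [_ fa] := Kf'.
  have km0 : 0 <= k%:Z * m by rewrite mulr_ge0.
  have Hr := Hinf_mul Hb1 (H2_zmul km0 Hg1).
  rewrite -(fa _ Hr); apply: L2dot_aeqM => //.
  - exact/Wadj_L2/H2_L2.
  - by apply: L2_bmul; [exact: inner_Linf|exact: H2_L2].
  (* Here [g beta(z^k) = a1 g1 beta(z^k) = alpha b1 g1], and [f] is orthogonal to [alpha H^2]. *)
  apply: (aeq_mono2 eg ea) => z oz e1 e2.
  have -> : Wadj k (fun z => beta z * zpow m z) z =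
      Wadj k beta z * zpow (k%:Z * m) z by rewrite -Wadj_zpow.
  have -> : phi z = (a1 z * g1 z)^* by rewrite -e1 /g cJK.
  transitivity (f z * (zpow (k%:Z * m) z)^* * (g1 z)^* * (a1 z * Wadj k beta z)^*).
    by rewrite !cJM; ring.
  by rewrite e2 !cJM; ring.
have Uv : aeq (U f) v.
  apply: aeq_trans (symU Kf) _; apply: aeq_sym; apply: orthproj_model_eq => //.
  move=> h /model_H2 Hh; rewrite L2dotB//; last exact: H2_L2.
  by rewrite vdot// subrr.
have Lz := L2_zpow (R := R) n.
rewrite (L2dot_aeq (UL2 Kf') Lz Lv Lz Uv (aeq_refl _)) vdot; last exact: H2_zpow.
exact: Wop_symbol_coef.
Qed.

(** Both sides are bounded functionals of [f], and bounded functions are dense in K_alpha. *)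
Lemma coef_extend f n : model alpha f -> 0 <= n ->
  L2dot (U f) (zpow n) = L2dot f (fun z => zpow (k%:Z * n) z * g z).
Proof.
move=> Kf n0.
have [l1 c1] := functional_U (L2_zpow (R := R) n).
have [l2 c2] := L2dot_functional (model_compl alpha) (L2_zmul (k%:Z * n) Lg).
apply: (model_functional_eq ia l1 c1 l2 c2) Kf => f' Kf'.
exact: coef_of_has_symbol.
Qed.

(** At index [n], both sides have the coefficient [<f, z^(k(n+1)) g>]; analyticity of [g] is what
    allows the powers of the shift to be moved onto it. *)
Lemma intertwines f : H2 g -> model alpha f ->
  aeq (cshift_adj beta (U f)) (U (iter k (cshift_adj alpha) f)).
Proof.
move=> Hg Kf; have KU := UK Kf.
have [KS _] := cshift_adjP ib KU.
have [KI dI] := iter_cshift_adjP k ia Kf.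
apply: H2_eq (model_H2 KS) (model_H2 (UK KI)) _ => n n0.
have kn0 : 0 <= k%:Z * n by rewrite mulr_ge0.
rewrite cshift_adj_dot//; last exact: H2_zpow.
rewrite (coef_extend KI n0) dI; last exact: H2_zmul.
have -> : L2dot (U f) (fun z => zpow 1 z * zpow n z) = L2dot (U f) (zpow (n + 1)).
  by apply: L2dot_ext => z oz; rewrite [n + 1]addrC zpowD.
rewrite coef_extend//; last by rewrite addr_ge0.
apply: L2dot_ext => z oz; congr (_ * (_)^*).
by rewrite mulrDr mulr1 addrC zpowD// mulrA.
Qed.

End Sufficiency.
End Operator.

Lemma coef_of_intertwining (k : nat) alpha beta U :
  is_inner alpha -> is_inner beta ->
  bounded_linear (model alpha) (model beta) U ->
  (forall f, model alpha f ->
     aeq (cshift_adj beta (U f)) (U (iter k (cshift_adj alpha) f))) ->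
  exists2 g, model alpha g & forall f n, model alpha f -> 0 <= n ->
    L2dot (U f) (zpow n) = L2dot f (fun z => zpow (k%:Z * n) z * g z).
Proof.
move=> ia ib bU inter; have [UK _ _ _] := bU.
have [lin bnd] := functional_U ia bU (L2_zpow (R := R) 0).
have [g Kg gP] := riesz (model_compl_L2 (inner_Linf ia)) lin bnd.
rewrite -modelE in Kg gP; exists g => // f [n|//] Kf _.
(* The relation holds only up to null sets, so iterating it needs [cshift_adj] to respect [aeq]. *)
have inter_n m : aeq (iter m (cshift_adj beta) (U f))
    (U (iter (k * m) (cshift_adj alpha) f)).
  elim: m => [|m IH]; first by rewrite muln0; exact: aeq_refl.
  have [Km _] := iter_cshift_adjP (k * m) ia Kf.
  have [Kb _] := iter_cshift_adjP m ib (UK _ Kf).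
  rewrite iterS mulnS iterD.
  apply: aeq_trans (inter _ Km); apply: cshift_adj_aeq => //; exact: UK.
have [Kn _] := iter_cshift_adjP n ib (UK _ Kf).
have [Kkn dkn] := iter_cshift_adjP (k * n) ia Kf.
have H1 : H2 (zpow 0 : C -> C) by exact: H2_zpow.
have [_ dn] := iter_cshift_adjP n ib (UK _ Kf).
have L0 := L2_zpow (R := R) 0.
transitivity (L2dot (iter n (cshift_adj beta) (U f)) (zpow 0)).
  by rewrite dn// mul_zpow0.
rewrite (L2dot_aeq (model_L2 Kn) L0 (model_L2 (UK _ Kkn)) L0 (inter_n n) (aeq_refl _)).
by rewrite gP// dkn ?PoszM//; exact: model_H2 Kg.
Qed.

End Symbols.

Theorem theorem3p8 (R : realType) (k : nat) (alpha beta gamma : R[i] -> R[i])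
    (U : (R[i] -> R[i]) -> (R[i] -> R[i])) :
  (0 < k)%N ->
  is_inner alpha -> ~ is_constant alpha ->
  is_inner beta -> ~ is_constant beta ->
  dim_ge (model alpha) k ->
  is_inner_gcd alpha (Wadj k beta) gamma ->
  bounded_linear (model alpha) (model beta) U ->
  (forall f, model alpha f ->
     aeq (cshift_adj beta (U f)) (U (iter k (cshift_adj alpha) f)))
  <->
  (Sclass k alpha beta U /\
   exists2 phi, conj_z_model alpha gamma phi & has_symbol k alpha beta phi U).
Proof.
move=> k0 ia _ ib _ _ gcdg bU.
have [ig [a1 ia1 ea] [b1 ib1 eb] _] := gcdg.
split => [inter|[_ [phi /(conj_z_modelP phi ia ig ia1 ea) [Lphi [g1 Kg1 eg]] symU]]].
  have [g Kg coefU] := coef_of_intertwining ia ib bU inter.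
  have Hg := model_H2 Kg; have Lg := H2_L2 Hg.
  pose phi z := (g z)^*.
  have Lphi : L2 phi by exact: L2J.
  have phiJ : (fun z => (phi z)^*) = g by apply/funext => z; rewrite /phi cJK.
  have coefU' f n : model alpha f -> 0 <= n -> L2dot (U f) (zpow n) =
      L2dot f (fun z => zpow (k%:Z * n) z * (phi z)^*).
    move=> Kf n0; rewrite coefU//; apply: L2dot_ext => z _.
    by rewrite /phi cJK.
  have symU := has_symbol_of_coef k0 ib Lphi bU coefU'.
  have Hgb := inner_Hinf (inner_mul ig ib1).
  have Hq : H2 (fun z => (alpha z)^* * (gamma z * b1 z * (phi z)^*)).
    apply: (symbol_divisible k0 ia ib Lphi bU coefU' _ Hgb eb).
    by rewrite phiJ.
  have Hq1 : H2 (fun z => (a1 z)^* * g z).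
    (* The relation [g b1 = a1 q], with [q = conj(alpha) gamma b1 g], is obtained after
       multiplication by [gamma], since [gamma a1 = alpha]. *)
    apply: (coprime_divides ia1 ib1 _ Hg Hq).
      by move=> t; apply: (gcd_quotients_coprime gcdg ia1 ib1 ea eb).
    apply: (inner_cancel ig).
    apply: (aeq_mono2 ea (inner_unit ia)) => z _ e1 e2.
    rewrite /phi cJK !mulrA -e1 e2; ring.
  have Kg1 : model gamma (fun z => (a1 z)^* * g z).
    (* Pairing [conj(a1) g] with [gamma p] is pairing [g] with [alpha p], and [g] is in K_alpha. *)
    split => // p Hp; have [_ ga] := Kg; rewrite -(ga p Hp).
    have Lp := H2_L2 Hp.
    apply: L2dot_aeqM => //.
    - exact: H2_L2.
    - by apply: L2_bmul => //; exact: inner_Linf.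
    - by apply: L2_bmul => //; exact: inner_Linf.
    by apply: (aeq_mono ea) => z _ ->; rewrite !cJM; ring.
  have cz : conj_z_model alpha gamma phi.
    apply/(conj_z_modelP phi ia ig ia1 ea); split => //.
    exists (fun z => (a1 z)^* * g z) => //.
    by apply: (aeq_mono (inner_unit ia1)) => z _ e; rewrite /phi cJK mulrA e mul1r.
  by split; [split => //; exists phi|exists phi].
have Hg1 := model_H2 Kg1.
have Hg : H2 (fun z => (phi z)^*).
  by apply: H2_aeq (Hinf_mul (inner_Hinf ia1) Hg1) (L2J Lphi) (aeq_sym eg).
move=> f Kf; apply: (intertwines k0 ia ib Lphi bU symU eg _ Hg1 (inner_Hinf ib1)) => //.
by apply: (aeq_mono2 ea eb) => z _ -> ->; ring.
Qed.
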